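(* Let $F=f+\psi$ be strictly convex and let $\{x_k\}$ be the iterates of the Super-Universal Newton Method (described in the context) with parameters $\alpha\in[\tfrac23,1]$ and $H_0>0$ satisfying $H_0\le\mathcal H_\alpha(g_0)$. Let $q\in[2,4]$ with $M_q<+\infty$ and let $2\le s<q$ with $D_s<+\infty$. Put $$\zeta=\frac{q-s}{(s-1)(q-1)},\qquad \Delta=\left[\frac{V_F^{1/(s-1)}}{16\,D_s^{s/(s-1)}(6M_q)^{1/(q-1)}}\right]^{1/\zeta}.$$ Assume that the initial gradient is small enough: $g_0\le\frac1e\Delta$. Then, for any $\delta>0$, by doing $$k=\Bigl\lceil\frac{1}{\ln(1+\zeta)}\ln\ln\frac{\Delta}{\delta}\Bigr\rceil$$ iterations, we have $g_k\le\delta$.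
   Context: Spaces and norms. $\mathbb E$ is a finite-dimensional real vector space, $\mathbb E^*$ its dual, $\langle s,x\rangle$ the value of $s\in\mathbb E^*$ at $x\in\mathbb E$. $B:\mathbb E\to\mathbb E^*$ is a fixed self-adjoint positive-definite linear operator; $\|x\|=\langle Bx,x\rangle^{1/2}$ on $\mathbb E$ and $\|s\|_*=\langle s,B^{-1}s\rangle^{1/2}$ on $\mathbb E^*$. Norms of symmetric multilinear forms are induced: $\|\nabla^pf(x)\|=\max\{\nabla^pf(x)[h_1,\dots,h_p]:\ \|h_i\|\le1\}$. Notation: $\nabla^2 f(x)[h]^2=\langle\nabla^2f(x)h,h\rangle$. Problem. $\min_{x\in\operatorname{dom}\psi}\{F(x)=f(x)+\psi(x)\}$, where $f:\mathbb E\to\mathbb R$ is convex and several times differentiable and $\psi:\mathbb E\to\mathbb R\cup\{+\infty\}$ is a proper closed convex function. Smoothness constants. $L_{p,\nu}=\sup_{x\ne y}\|\nabla^pf(x)-\nabla^pf(y)\|/\|x-y\|^\nu$ for $p\in\{2,3\}$, $\nu\in[0,1]$ (equal to $+\infty$ if the supremum is infinite or $\nabla^pf$ does not exist). For $2\le q\le4$: $M_{2+\nu}=L_{2,\nu}$ for $\nu\in[0,1)$ and $M_{3+\nu}=L_{3,\nu}$ for $\nu\in[0,1]$. Relative size. $\mathcal F_0=\{x\in\operatorname{dom}\psi:\ F(x)\le F(x_0)\}$ (with more than one point) and $D=\sup_{x,y\in\mathcal F_0}\|x-y\|$, assumed finite. Fix a selection of subgradients $G_x\in\partial F(x)$, $x\in\mathcal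 F_0$, and let $\beta_F(x,y)=\langle G_x-G_y,x-y\rangle$ (positive for $x\ne y$ by strict convexity), $V_F=\sup_{x,y\in\mathcal F_0}\beta_F(x,y)$, assumed finite, $\xi_F(x,y)=\beta_F(x,y)/V_F$. For $2\le s<\infty$ the $s$-relative size is $D_s=\sup_{x,y\in\mathcal F_0,\,x\ne y}\|x-y\|\,\xi_F(x,y)^{-1/s}$. Function $\mathcal H_\alpha$. For $t>0$, $\mathcal H_\alpha(t)=\inf_{2\le q\le4}(6M_q)^{\frac1{q-1}}\bigl(\tfrac1t\bigr)^{\alpha-\frac{q-2}{q-1}}$. Super-Universal Newton Method. Input: $x_0\in\operatorname{dom}\psi$, $\psi'(x_0)\in\partial\psi(x_0)$, arbitrary $\alpha\in[\frac23,1]$, $H_0>0$. For $k=0,1,\dots$: set $F'(x_k)=\nabla f(x_k)+\psi'(x_k)$ and $g_k=\|F'(x_k)\|_*$. For $j_k=0,1,2,\dots$ put $\lambda_k=4^{j_k}H_kg_k^\alpha$, $x_+=\operatorname{argmin}_x\{\langle\nabla f(x_k),x-x_k\rangle+\frac12\nabla^2f(x_k)[x-x_k]^2+\frac{\lambda_k}2\|x-x_k\|^2+\psi(x)\}$, $\psi'(x_+)=-\nabla f(x_k)-\nabla^2f(x_k)(x_+-x_k)-\lambda_kB(x_+-x_k)\in\partial\psi(x_+)$, $F'(x_+)=\nabla f(x_+)+\psi'(x_+)$, stopping at the first $j_k$ for which $\langle F'(x_+),x_k-x_+\rangle\ge\frac{1}{4\lambda_k}\|F'(x_+)\|_*^2$.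 Then set $x_{k+1}=x_+$ (with the corresponding $\psi'(x_{k+1})$) and $H_{k+1}=4^{j_k}H_k/4$. Here $g_0>0$; if $g_k=0$ for some $k$, then $x_k$ is a minimizer, the method stops, and one sets $x_i=x_k$, $g_i=0$ for $i>k$. *)

(* Defs.v *)
From HB Require Import structures.
From mathcomp Require Import all_boot all_order all_algebra.
From mathcomp Require Import all_classical all_reals all_analysis.
From mathcomp Require Import ring lra.

Set Implicit Arguments.
Unset Strict Implicit.
Unset Printing Implicit Defensive.

Import Order.TTheory GRing.Theory Num.Theory.
Import numFieldNormedType.Exports.

Local Open Scope classical_set_scope.
Local Open Scope ring_scope.

Record metric_op (R : realType) (V : vectType R) := MetricOp {
  metric :> 'Hom(V, 'Hom(V, R));
  metric_selfadjoint : forall x y : V, metric x y = metric y x;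
  metric_posdef : forall x : V, x != 0 -> 0 < metric x x
}.

(* [V] normed by [sqrt <B x, x>], so that [`|x|], the topology and the
   (Frechet) differentiability of the library all refer to this norm. *)
Definition euclid (R : realType) (V : vectType R) (B : metric_op V) : Type := V.

HB.instance Definition _ (R : realType) (V : vectType R) (B : metric_op V) :=
  Vector.copy (euclid B) V.

Section EuclidNorm.
Context (R : realType) (V : vectType R) (B : metric_op V).
Implicit Types (x y : euclid B) (l : R).

Definition euclid_norm x : R := Num.sqrt (B x x).

Let metric_ge0 x : 0 <= B x x.
Proof.
have [->|x0] := eqVneq x 0; first by rewrite linear0 lexx.
exact/ltW/metric_posdef.
Qed.

Let metricDD x y l :
  B (x + l *: y) (x + l *: y) = B x x + 2 * l * B x y + l ^+ 2 * B y y.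
Proof.
rewrite !linearD !linearZ /= !add_lfunE !scale_lfunE.
rewrite (metric_selfadjoint B y x) /GRing.scale /=.
by ring.
Qed.

Let cauchy_schwarz x y : B x y <= euclid_norm x * euclid_norm y.
Proof.
have [->|y0] := eqVneq y 0.
  by rewrite linear0 mulr_ge0// sqrtr_ge0.
have Byy := metric_posdef B y0.
rewrite /euclid_norm -sqrtrM ?metric_ge0//.
apply: le_trans (ler_norm _) _; rewrite -sqrtr_sqr ler_wsqrtr//.
have := metric_ge0 (x + (- (B x y / B y y)) *: y).
rewrite metricDD => h.
have : 0 <= B y y * (B x x + 2 * - (B x y / B y y) * B x y
               + (- (B x y / B y y)) ^+ 2 * B y y) by rewrite mulr_ge0// ltW.
suff -> : B y y * (B x x + 2 * - (B x y / B y y) * B x y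
   + (- (B x y / B y y)) ^+ 2 * B y y) = B x x * B y y - B x y ^+ 2.
  by rewrite subr_ge0.
by field; rewrite gt_eqF.
Qed.

Let ler_euclid_normD x y :
  euclid_norm (x + y) <= euclid_norm x + euclid_norm y.
Proof.
rewrite -(@ler_pXn2r _ 2)// ?nnegrE ?addr_ge0 ?sqrtr_ge0//.
rewrite sqrrD !sqr_sqrtr ?metric_ge0//.
have := metricDD x y 1; rewrite scale1r => ->.
have := cauchy_schwarz x y; lra.
Qed.

Let euclid_normZ l x : euclid_norm (l *: x) = `|l| * euclid_norm x.
Proof.
rewrite /euclid_norm !linearZ /= scale_lfunE /GRing.scale /= mulrA -expr2.
by rewrite sqrtrM ?sqr_ge0// sqrtr_sqr.
Qed.

Let euclid_norm0_eq0 x : euclid_norm x = 0 -> x = 0.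
Proof.
move=> /eqP; rewrite sqrtr_eq0 => Bx0; apply/eqP.
apply: contraT => x0; have := metric_posdef B x0.
by rewrite ltNge Bx0.
Qed.

HB.instance Definition _ := Lmodule_isNormed.Build R (euclid B)
  ler_euclid_normD euclid_normZ euclid_norm0_eq0.

End EuclidNorm.

Section Problem.
Context (R : realType) (V : vectType R) (B : metric_op V).
Local Notation E := (euclid B).
Local Notation E' := 'Hom(euclid B, R).

Definition dual_norm (s : E') : R :=
  Num.sqrt (s ((metric B)^-1%VF s)).

(* [Dform f [:: h1; ...; hp] x] is the p-linear form D^p f(x)[h1, ..., hp]. *)
Definition Dform (f : E -> R) (hs : seq E) : E -> R :=
  foldr (fun h g => 'D_h g) f hs.

(* As [E] is finite dimensional, the derivative of order p is differentiable
   iff each scalar function [Dform f hs], [size hs = p], is. *)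
Fixpoint times_differentiable (p : nat) (f : E -> R) : Prop :=
  if p is p'.+1 then
    (forall x, differentiable f x) /\
    (forall h, times_differentiable p' ('D_h f))
  else True.

Definition form_norm (p : nat) (A : p.-tuple E -> R) : \bar R :=
  ereal_sup [set (A h)%:E | h in
    [set h : p.-tuple E | forall i : 'I_p, `|tnth h i| <= 1]].

Definition L_const (f : E -> R) (p : nat) (nu : R) : \bar R :=
  if `[< times_differentiable p f >] then
    ereal_sup [set (form_norm (fun h : p.-tuple E =>
                     (Dform f h z.1 - Dform f h z.2)%R)
                    * ((`|z.1 - z.2| `^ nu)^-1)%:E)%E
              | z in [set z : E * E | z.1 != z.2]]
  else +oo%E.

(* Only meant for 2 <= q <= 4. *)
Definition M_const (f : E -> R) (q : R) : \bar R :=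
  if q < 3 then L_const f 2 (q - 2) else L_const f 3 (q - 3).

Definition H_bound (f : E -> R) (alpha t : R) : \bar R :=
  ereal_inf [set (poweR (6%:E * M_const f q) (q - 1)^-1
                  * ((t^-1) `^ (alpha - (q - 2) / (q - 1)))%:E)%E
            | q in [set q : R | 2 <= q <= 4]].

Definition grad (f : E -> R) (x : E) : E' := linfun ('d f x).

Definition hess (f : E -> R) (x h : E) : E' :=
  linfun (fun v => Dform f [:: h; v] x).

Implicit Types (phi psi : E -> \bar R).

Definition edom phi : set E := [set x | (phi x < +oo)%E].

Definition epigraph phi : set (E * R) := [set p | (phi p.1 <= p.2%:E)%E].

Definition proper_closed_convex psi : Prop :=
  [/\ (forall x, psi x != -oo%E), edom psi !=set0,
      closed (epigraph psi) & convex_set (epigraph psi)].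

Definition strictly_convex phi : Prop :=
  forall (x y : E) (t : R), edom phi x -> edom phi y -> x != y ->
    0 < t < 1 ->
    (phi (t *: x + (1 - t) *: y)%R < t%:E * phi x + (1 - t)%:E * phi y)%E.

Definition subdiff phi (x : E) : set E' :=
  [set s | edom phi x /\ forall y, (phi x + (s (y - x)%R)%:E <= phi y)%E].

Definition objective (f : E -> R) psi : E -> \bar R :=
  fun x => ((f x)%:E + psi x)%E.

(* Since [f] is finite, [dom psi] is the domain of [phi = f + psi]. *)
Definition sublevel phi (x0 : E) : set E :=
  [set x | edom phi x /\ (phi x <= phi x0)%E].

Definition diameter (A : set E) : \bar R :=
  ereal_sup [set `|z.1 - z.2|%:E | z in A `*` A].

Definition beta_F (G : E -> E') (x y : E) : R := (G x - G y) (x - y).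

Definition V_F (G : E -> E') (A : set E) : \bar R :=
  ereal_sup [set (beta_F G z.1 z.2)%:E | z in A `*` A].

Definition xi_F (G : E -> E') (A : set E) (x y : E) : R :=
  beta_F G x y / fine (V_F G A).

Definition relative_size (G : E -> E') (A : set E) (s : R) : \bar R :=
  ereal_sup [set (`|z.1 - z.2| * xi_F G A z.1 z.2 `^ (- s^-1))%:E
            | z in [set z : E * E | [/\ A z.1, A z.2 & z.1 != z.2]]].

(* The data carried by the method: the point x_k, the subgradient psi'(x_k)
   and the regularization constant H_k. *)
Record newton_state := NewtonState {
  cur_point : E;
  cur_subgrad : E';
  cur_reg : R
}.

Definition comp_grad (f : E -> R) (x : E) (s : E') : E' := grad f x + s.

Definition grad_size (f : E -> R) (st : newton_state) : R :=
  dual_norm (comp_grad f (cur_point st) (cur_subgrad st)).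

Definition newton_model (f : E -> R) psi (x : E) (lambda : R) (y : E) : \bar R :=
  ((grad f x (y - x) + 2^-1 * hess f x (y - x) (y - x)
    + lambda / 2 * `|y - x| ^+ 2)%R%:E + psi y)%E.

Definition is_newton_point (f : E -> R) psi (x : E) (lambda : R) (y : E) : Prop :=
  forall z, (newton_model f psi x lambda y <= newton_model f psi x lambda z)%E.

Definition newton_subgrad (f : E -> R) (x : E) (lambda : R) (y : E) : E' :=
  - grad f x - hess f x (y - x) - lambda *: metric B (y - x).

Definition accepted (f : E -> R) (x : E) (lambda : R) (y : E) : Prop :=
  let F' := comp_grad f y (newton_subgrad f x lambda y) in
  (4 * lambda)^-1 * dual_norm F' ^+ 2 <= F' (x - y).

Definition newton_step (f : E -> R) psi (alpha : R) (st st' : newton_state)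
    : Prop :=
  if grad_size f st == 0 then st' = st else
  exists j : nat,
    let lambda i := 4 ^+ i * cur_reg st * grad_size f st `^ alpha in
    [/\ is_newton_point f psi (cur_point st) (lambda j) (cur_point st')
         /\ accepted f (cur_point st) (lambda j) (cur_point st'),
        (forall i z, (i < j)%N ->
           is_newton_point f psi (cur_point st) (lambda i) z ->
           ~ accepted f (cur_point st) (lambda i) z),
        cur_subgrad st' = newton_subgrad f (cur_point st) (lambda j) (cur_point st')
      & cur_reg st' = 4 ^+ j * cur_reg st / 4].

Definition newton_run (f : E -> R) psi (alpha : R) (st : nat -> newton_state)
    : Prop :=
  [/\ edom psi (cur_point (st 0%N)),
      subdiff psi (cur_point (st 0%N)) (cur_subgrad (st 0%N)),
      0 < cur_reg (st 0%N)
    & forall k, newton_step f psi alpha (st k) (st k.+1)].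

End Problem.

(* Main.v *)
(* Write g = g_k, r = |x_k - x_(k+1)| and p = (q-2)/(q-1).  A trial value lambda
   is accepted as soon as 6 M_q (g / lambda)^(q-2) <= lambda: optimality of the
   trial point gives lambda r^2 + D^2 f(x_k)[h, h] <= g r, hence r <= g / lambda,
   and the Taylor residual of the gradient is then at most lambda r.  Thus every
   rejected lambda is at most (6 M_q)^(1/(q-1)) g^p, the accepted one is at most
   four times larger, and H_k g_k^alpha <= (6 M_q)^(1/(q-1)) g_k^p is preserved
   as long as g_k decreases, because p <= 2/3 <= alpha.

   Acceptance means g_(k+1) <= 4 lambda r.  By definition of the relative size,
   F is uniformly convex of degree s on the sublevel set, so V_F r^s <= D_s^s g r,
   i.e. r is of order g^(1/(s-1)).  Together
   g_(k+1) / Delta <= (g_k / Delta)^(1 + zeta), whence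
   g_k <= Delta exp (- (1 + zeta)^k). *)

From HB Require Import structures.
Require Import Defs.
From mathcomp Require Import all_boot all_order all_algebra.
From mathcomp Require Import all_classical all_reals all_analysis.
From mathcomp Require Import ring lra.

Set Implicit Arguments.
Unset Strict Implicit.
Unset Printing Implicit Defensive.

Import Order.TTheory GRing.Theory Num.Theory.
Import numFieldNormedType.Exports.

Local Open Scope classical_set_scope.
Local Open Scope ring_scope.

(** * Dual norm *)

Section Euclid.
Context (R : realType) (V : vectType R) (B : metric_op V).
Local Notation E := (euclid B).
Local Notation E' := 'Hom(euclid B, R).
Implicit Types (x y : E) (s : E').

Lemma metric_ge0 x : 0 <= B x x.
Proof.
have [->|x0] := eqVneq x 0; first by rewrite linear0 lexx.
exact/ltW/metric_posdef.
Qed.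

Lemma euclid_normE x : `|x| = Num.sqrt (B x x).
Proof. by []. Qed.

Lemma sqr_euclid_norm x : `|x| ^+ 2 = B x x.
Proof. by rewrite euclid_normE sqr_sqrtr// metric_ge0. Qed.

Lemma metricDr x y z : B x (y + z) = B x y + B x z.
Proof. exact: linearD. Qed.

Lemma metricZr a x y : B x (a *: y) = a * B x y.
Proof. exact: linearZ. Qed.

Lemma metricDl x y z : B (y + z) x = B y x + B z x.
Proof. by rewrite !(metric_selfadjoint B _ x) metricDr. Qed.

Lemma metricZl a x y : B (a *: y) x = a * B y x.
Proof. by rewrite !(metric_selfadjoint B _ x) metricZr. Qed.

Lemma metricBl x y z : B (y - z) x = B y x - B z x.
Proof. by rewrite -scaleN1r metricDl metricZl mulN1r. Qed.

(** Cauchy-Schwarz, from nonnegativity of [B] at the residual of projecting [x] on [y]. *)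
Lemma metric_le_norm x y : B x y <= `|x| * `|y|.
Proof.
have [->|y0] := eqVneq y 0; first by rewrite linear0 normr0 mulr0.
have Byy := metric_posdef B y0.
have y1 : 0 < `|y| by rewrite normr_gt0.
have := sqr_ge0 (`|x| * `|y|).
have h := metric_ge0 (x + (- (B x y / B y y)) *: y).
have {h} : 0 <= B x x * B y y - B x y ^+ 2.
  move: h; rewrite !(metricDr, metricDl, metricZr, metricZl).
  rewrite (metric_selfadjoint B y x).
  move/(mulr_ge0 (ltW Byy)); congr (_ <= _).
  by field; rewrite gt_eqF.
rewrite -!sqr_euclid_norm -exprMn subr_ge0 => h _.
apply: le_trans (ler_norm _) _.
by rewrite -(@ler_pXn2r _ 2) ?nnegrE ?mulr_ge0// real_normK// num_real.
Qed.

(** Positive definiteness makes [B] injective, and [E] and its dual have equal dimension, so [B] is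
    onto. The representer [u] turns questions about [dual_norm] into questions about the norm of
    [E]. *)
Lemma metric_surj s : exists2 u : E, B u = s & dual_norm s = `|u|.
Proof.
have kerB : lker (metric B) == 0%VS.
  apply/lker0P => x y Bxy; apply/eqP; rewrite -subr_eq0; apply: contraT => xy0.
  by have := metric_posdef B xy0; rewrite metricBl Bxy subrr ltxx.
have imB : limg (metric B) = fullv.
  apply/eqP; rewrite eqEdim subvf /= limg_dim_eq; last first.
    by apply/eqP; rewrite (eqP kerB) capv0.
  by rewrite !dimvf /dim /= muln1.
have Bs : B ((metric B)^-1%VF s) = s by rewrite limg_lfunVK// imB memvf.
exists ((metric B)^-1%VF s) => //.
by rewrite /dual_norm euclid_normE Bs.
Qed.

Lemma dual_norm_metric x : dual_norm (B x : E') = `|x|.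
Proof.
have [u Bu ->] := metric_surj (B x : E').
suff -> : u = x by [].
apply/eqP; rewrite -subr_eq0; apply: contraT => ux0.
by have := metric_posdef B ux0; rewrite metricBl Bu subrr ltxx.
Qed.

Lemma dual_norm_ge0 s : 0 <= dual_norm s.
Proof. exact: sqrtr_ge0. Qed.

Lemma le_dual_norm s x : s x <= dual_norm s * `|x|.
Proof.
by have [u <- _] := metric_surj s; rewrite dual_norm_metric metric_le_norm.
Qed.

Lemma dual_norm_attained s :
  exists2 v : E, `|v| <= 1 & dual_norm s = s v.
Proof.
have [u Bu ->] := metric_surj s; rewrite -Bu.
have [->|u0] := eqVneq u 0; first by exists 0; rewrite ?normr0// linear0.
have u1 : 0 < `|u| by rewrite normr_gt0.
exists (`|u|^-1 *: u).
  by rewrite normrZ normfV normr_id mulVf// gt_eqF.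
by rewrite metricZr -sqr_euclid_norm expr2 mulKf// gt_eqF.
Qed.

End Euclid.

(** * Compactness in finite dimension and existence of minimizers *)

Import VectorInternalTheory.

Lemma linear_rV_continuous (R : realType) (n : nat) (W : normedModType R)
    (l : {linear 'rV[R]_n -> W}) : continuous l.
Proof.
have -> : (l : _ -> _) = (fun u => \sum_(i < n) u 0 i *: l (delta_mx 0 i)).
  apply/funext => u; rewrite {1}(row_sum_delta u) linear_sum.
  by apply: eq_bigr => i _; rewrite linearZ.
apply: continuous_big; first exact: add_continuous.
move=> i _ x.
apply: (@cvgZr_tmp _ _ _ (nbhs x) _ (fun u => u 0 i) (x 0 i)).
exact: (@coord_continuous R 1 n 0 i x).

Qed.

Section FiniteDimension.
Context (R : realType) (V : vectType R) (B : metric_op V).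
Local Notation E := (euclid B).

Let ofc : {linear 'rV[R]_(dim E) -> E} := r2v.
Let toc : {linear E -> 'rV[R]_(dim E)} := v2r.
Let ofcK : cancel ofc toc := r2vK.
Let tocK : cancel toc ofc := v2rK.

(** On the compact unit sphere of coordinates $\|ofc(u)\|$ attains its minimum, which is positive
    because [ofc] is injective; homogeneity does the rest. *)
Lemma coord_norm_lower_bound :
  exists2 c : R, 0 < c & forall u, c * `|u| <= `|ofc u|.
Proof.
pose n := dim E; pose S := [set u : 'rV[R]_n | `|u| = 1].
(* In dimension zero the sphere is empty and every [u] is zero. *)
have [S0|/set0P S0] := eqVneq S set0.
  exists 1 => // u; have [->|u0] := eqVneq u 0.
    by rewrite normr0 mulr0.
  have : S (`|u|^-1 *: u).
    by rewrite /S /= normrZ normfV normr_id mulVf// normr_eq0.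
  by rewrite S0.
have cS : compact S.
  apply: bounded_closed_compact.
    by exists 1; split => // y y1 u /= ->; exact: ltW.
  have -> : S = (fun u : 'rV[R]_n => `|u|) @^-1` [set 1] by [].
  apply: preimage_closed; last exact: closed_eq.
  by move=> u _; exact: norm_continuous.
have /= cf : {within S, continuous (fun u : 'rV[R]_n => `|ofc u|)}.
  apply: continuous_subspaceT => u.
  apply: (@continuous_comp _ _ _ ofc); last exact: norm_continuous.
  exact: linear_rV_continuous.
have [m /set_mem Sm mP] := compact_EVT_min S0 cS cf.
have m0 : (ofc m) != 0.
  rewrite -(linear0 ofc) (inj_eq (can_inj ofcK)).
  by rewrite -normr_eq0 Sm oner_neq0.
exists `|ofc m|; first by rewrite normr_gt0.
move=> u; have [->|u0] := eqVneq u 0; first by rewrite normr0 mulr0.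
have u1 : 0 < `|u| by rewrite normr_gt0.
have /mP : `|u|^-1 *: u \in S.
  by rewrite inE /S /= normrZ normfV normr_id mulVf// gt_eqF.
rewrite linearZ normrZ normfV normr_id => h.
by rewrite mulrC -ler_pdivlMl.
Qed.

Lemma coord_map_continuous : continuous toc.
Proof.
have [c c0 cP] := coord_norm_lower_bound.
apply: bounded_linear_continuous; apply/linear_boundedP.
near=> r => x; have := cP (toc x); rewrite tocK mulrC -ler_pdivlMr// => h.
apply: (le_trans h); rewrite mulrC ler_wpM2r//.
Unshelve. all: by end_near. Qed.

Lemma linear_euclid_continuous (W : normedModType R) (l : {linear E -> W}) :
  continuous l.
Proof.
have -> : (l : _ -> _) = (l \o ofc : {linear _ -> _}) \o toc.
  by apply/funext => x /=; rewrite tocK.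
move=> x; apply: continuous_comp; first exact: coord_map_continuous.
exact: linear_rV_continuous.
Qed.

Lemma euclid_ball_compact (r : R) : compact [set x : E | `|x| <= r].
Proof.
have [c c0 cP] := coord_norm_lower_bound.
pose K := ofc @^-1` [set x : E | `|x| <= r].
have ofcC : continuous ofc by exact: linear_rV_continuous.
have -> : [set x : E | `|x| <= r] = ofc @` K.
  apply/seteqP; split => [x xr|_ [u Ku <-]] //.
  by exists (toc x); rewrite /K /= tocK.
apply: continuous_compact; first exact: continuous_subspaceT.
apply: bounded_closed_compact.
  exists (r / c); split; first exact: num_real.
  move=> y ry u Ku; apply: le_trans (ltW ry).
  by rewrite ler_pdivlMr// mulrC (le_trans (cP u)).
apply: preimage_closed => [u _|]; first exact: ofcC.
have -> : [set x : E | `|x| <= r] = (fun x : E => `|x|) @^-1` [set t | t <= r] by [].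
apply: preimage_closed => [u _|]; [exact: norm_continuous|exact: closed_le].
Qed.

(** Only the second argument is expanded in coordinates: each term is a coordinate times a linear
    function of [h]. *)
Lemma bilinear_diag_continuous (b : E -> E -> R) :
  (forall h, linear (b h)) -> (forall v, linear (b ^~ v)) ->
  continuous (fun h => b h h).
Proof.
move=> br bl.
pose L h : {linear E -> R} := HB.pack (b h) (GRing.isLinear.Build _ _ _ _ _ (br h)).
pose L' v : {linear E -> R} :=
  HB.pack (b ^~ v) (GRing.isLinear.Build _ _ _ _ _ (bl v)).
have -> : (fun h => b h h) = (fun h =>
    \sum_(i < dim E) toc h 0 i * b h (ofc (delta_mx 0 i))).
  apply/funext => h; rewrite -[in LHS](tocK h).
  rewrite [in X in b _ X](row_sum_delta (toc h)) tocK linear_sum.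
  rewrite [LHS](linear_sum (L h)).
  by apply: eq_bigr => i _; rewrite linearZ; exact: (linearZ_LR (L h)).
apply: continuous_big; first exact: add_continuous.
move=> i _ x.
have ci : {for toc x, continuous (fun u : 'rV[R]_(dim E) => u 0 i)}.
  exact: (@coord_continuous R 1 _ 0 i (toc x)).
apply: continuousM; first exact: (continuous_comp (@coord_map_continuous x) ci).
exact: (@linear_euclid_continuous _ (L' (ofc (delta_mx 0 i))) x).
Qed.

(** [psi] is only lower semicontinuous, so the minimum is taken over points $(y,w)$ of its closed
    epigraph, where $Q(y)+w$ is continuous. Quadratic growth of [Q] against the affine minorant of
    [psi] at [x] confines the search to a compact set. *)
Lemma exists_min_add_epigraph (psi : E -> \bar R) (Q : E -> R) (x : E)
    (s : 'Hom(E, R)) (a b : R) :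
  proper_closed_convex psi -> subdiff psi x s ->
  continuous Q -> Q x = 0 -> 0 < b ->
  (forall y, - a * `|y - x| + b * `|y - x| ^+ 2 <= Q y) ->
  exists z, forall y, ((Q z)%:E + psi z <= (Q y)%:E + psi y)%E.
Proof.
move=> [psiN _ clpsi _] [domx sx] cQ Qx b0 Qlb.
have [w0 psix] : exists w0, psi x = w0%:E.
  by move: (psiN x) domx; rewrite /edom /=; case: (psi x) => // r; exists r.
rewrite psix in sx.
pose K := epigraph psi `&` [set p : E * R | Q p.1 + p.2 <= w0].
pose d := dual_norm s.
have Kw p : K p -> - d * `|p.1 - x| <= p.2 - w0.
  move=> [/= pe _]; have := le_trans (sx p.1) pe.
  rewrite -EFinD lee_fin => h.
  have := le_dual_norm s (x - p.1); rewrite -opprB linearN normrN -/d; lra.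
(* On [K], with $t=\|y-x\|$, growth and minorant give $bt^2\le(|a|+d)t$. *)
pose rho := (`|a| + d) / b.
have d0 : 0 <= d by exact: dual_norm_ge0.
have Kr p : K p -> `|p.1 - x| <= rho.
  move=> Kp; have := Kw _ Kp; have [_ /= h] := Kp; have := Qlb p.1.
  set t := `|p.1 - x|; have t0 : 0 <= t by exact: normr_ge0.
  move=> h1 h2; rewrite /rho ler_pdivlMr//.
  have ha : a * t <= `|a| * t by rewrite ler_wpM2r// ler_norm.
  have : t * (t * b) <= t * (`|a| + d) by rewrite expr2 in h1; nra.
  have [->|tn0] := eqVneq t 0; first by move=> _; rewrite mul0r addr_ge0 ?normr_ge0.
  by rewrite ler_pM2l// lt0r tn0.
have rho0 : 0 <= rho by rewrite divr_ge0 ?addr_ge0// ltW.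
have Kc : closed K.
  apply: closedI => //.
  have -> : [set p : E * R | Q p.1 + p.2 <= w0] =
    (fun p : E * R => Q p.1 + p.2) @^-1` [set t | t <= w0] by [].
  apply: preimage_closed; last exact: closed_le.
  move=> p _; apply: continuousD; last exact: cvg_snd.
  by apply: (@continuous_comp _ _ _ (@fst E R) Q); [exact: cvg_fst|exact: cQ].
have KK : compact K.
  apply: (@subclosed_compact _ _ ([set y | `|y| <= `|x| + rho] `*`
     `[w0 - d * rho, w0 + `|a| * rho])%classic) => //.
    apply: compact_setX; first exact: euclid_ball_compact.
    exact: segment_compact.
  move=> p Kp; have pr := Kr _ Kp; split => /=.
    by rewrite -[p.1](subrKC x) (le_trans (ler_normD _ _))// lerD2l.
  rewrite in_itv /=; have := Kw _ Kp; have [_ /= h] := Kp; have := Qlb p.1.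
  have := ler_wpM2l d0 pr; have := ler_wpM2l (normr_ge0 a) pr.
  have : - (`|a| * `|p.1 - x|) <= - a * `|p.1 - x|.
    by rewrite mulNr lerN2 ler_wpM2r// ler_norm.
  have : 0 <= b * `|p.1 - x| ^+ 2 by rewrite mulr_ge0 ?sqr_ge0// ltW.
  lra.
have Kx : K (x, w0) by split; rewrite /epigraph/= ?psix// Qx add0r.
have cf : {within K, continuous (fun p : E * R => Q p.1 + p.2)}.
  apply: continuous_subspaceT => p; apply: continuousD; last exact: cvg_snd.
  by apply: (@continuous_comp _ _ _ (@fst E R) Q); [exact: cvg_fst|exact: cQ].
have [[z w] /set_mem Kz zP] := compact_EVT_min (ex_intro _ _ Kx) KK cf.
exists z => y; apply: (@le_trans _ _ (Q z + w)%:E).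
  by have [/= h _] := Kz; rewrite EFinD leeD2l.
case E : (psi y) => [v| |]; last 2 first.
- by rewrite addey// leey.
- by move: (psiN y); rewrite E.
rewrite -EFinD lee_fin.
(* If $Q(y)+\psi(y)>w_0$, the point is outside [K], but [w0] already dominates the minimum over
   [K]. *)
have [h|h] := leP (Q y + v) w0.
  by apply: (zP (y, v)); rewrite inE; split => //; rewrite /epigraph/= E.
by have [_ /= h'] := Kz; exact: le_trans h' (ltW h).
Qed.

End FiniteDimension.

(** * Directional derivatives *)

Section DirectionalDerivatives.
Context (R : realType) (U : normedModType R).
Implicit Types (f g : U -> R) (x h v : U).

Lemma differentiable_near f x : differentiable f x ->
  forall e : R, 0 < e ->
  exists2 d : R, 0 < d & forall k, `|k| < d ->
    `|f (x + k) - f x - 'd f x k| <= e * `|k|.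
Proof.
move=> df e e0; have /diff_locally/eqaddoP/(_ _ e0) := df.
rewrite near_simpl => /nbhs_norm0P [d /= d0 dP]; exists d => // k kd.
have := dP _ kd; rewrite /= !fctE /= (addrC k).
by rewrite opprD addrA.
Qed.

Lemma derive_linear f x : differentiable f x -> linear (fun v => 'D_v f x).
Proof. by move=> df a u v; rewrite !deriveE// linearP. Qed.

Lemma deriveZv f x a v : differentiable f x -> 'D_(a *: v) f x = a * 'D_v f x.
Proof. by move=> df; rewrite !deriveE// linearZ. Qed.

Lemma is_derive_line f x h : (forall y, differentiable f y) ->
  forall t : R, is_derive t 1 (fun u => f (x + u *: h)) ('D_h f (x + t *: h)).
Proof.
move=> df t.
have dl : is_diff t (fun u : R => x + u *: h) (fun u : R => u *: h).
  by apply: is_diff_eq; rewrite add0r.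
have dfl : differentiable f (x + t *: h) by [].
have dc : differentiable (f \o (fun u : R => x + u *: h)) t.
  exact: differentiable_comp.
split; first exact: diff_derivable.
rewrite deriveE// (_ : (fun u => _) = f \o (fun u : R => x + u *: h))//.
by rewrite diff_comp//= diff_val scale1r deriveE.
Qed.

Lemma MVT_line f x h (a b : R) : (forall y, differentiable f y) -> a < b ->
  exists2 c, a < c < b &
    f (x + b *: h) - f (x + a *: h) = 'D_h f (x + c *: h) * (b - a).
Proof.
move=> df ab.
have [|t| |c cab ->] := @MVT R (fun u => f (x + u *: h))
  (fun u => 'D_h f (x + u *: h)) a b; first exact: ab.
- by move=> _; exact: is_derive_line.
- apply: continuous_subspaceT => t; apply: differentiable_continuous.
  by apply/derivable1_diffP; case: (is_derive_line x h df t).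
- by exists c; rewrite // in_itv in cab.
Qed.

Lemma MVT_line0 f x h (b : R) : (forall y, differentiable f y) -> 0 < b ->
  exists2 c, 0 < c < b & f (x + b *: h) - f x = 'D_h f (x + c *: h) * b.
Proof.
move=> df b0; have [c cb] := MVT_line x h df b0.
by rewrite scale0r addr0 subr0; exists c.
Qed.

Lemma MVT_line1 f x h : (forall y, differentiable f y) ->
  exists2 c, 0 < c < 1 & f (x + h) - f x = 'D_h f (x + c *: h).
Proof.
move=> df; have [c cb] := MVT_line0 x h df ltr01.
by rewrite scale1r mulr1; exists c.
Qed.

Let second_difference f x h v (t : R) :=
  f (x + t *: h + t *: v) - f (x + t *: h) - f (x + t *: v) + f x.

(** The mean value theorem along [h] for $g(y)=f(y+tv)-f(y)$ turns the second difference into $t$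
    times the difference of ['D_h f] at $x+ch+tv$ and $x+ch$; both values are expanded to first
    order at [x]. *)
Lemma second_difference_approx f x h v :
  (forall y, differentiable f y) -> differentiable ('D_h f) x ->
  forall e : R, 0 < e -> exists2 d : R, 0 < d & forall t : R, 0 < t < d ->
    `|second_difference f x h v t - t ^+ 2 * 'D_v ('D_h f) x| <= e * t ^+ 2.
Proof.
move=> df dfh e e0.
(* The displacements $ch+tv$ and $ch$ have total length at most $tC$. *)
pose C := 2 * `|h| + `|v| + 1.
have C0 : 0 < C by rewrite ltr_wpDl// addr_ge0// mulr_ge0.
have [d d0 dP] := differentiable_near dfh (divr_gt0 e0 C0).
exists (d / C); first by rewrite divr_gt0.
move=> t /andP[t0]; rewrite ltr_pdivlMr// => tC.
pose g y := f (y + t *: v) - f y.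
have dg y : is_diff y g (fun k => 'd f (y + t *: v) k - 'd f y k).
  have ds : is_diff y (fun z => z + t *: v) id.
    by apply: is_diff_eq; rewrite addr0.
  have dc : differentiable (f \o (fun z => z + t *: v)) y.
    exact: differentiable_comp.
  have dfc : is_diff y (fun z => f (z + t *: v)) ('d f (y + t *: v)).
    by split => //; rewrite diff_comp//= diff_val.
  have dfy : is_diff y f ('d f y) by split.
  exact: is_diffB.
have Dg y : 'D_h g y = 'D_h f (y + t *: v) - 'D_h f y.
  by rewrite !deriveE// diff_val.
have gd y : differentiable g y by exact: ex_diff.
have [c /andP[c0 ct]] := @MVT_line g x h 0 t gd t0.
rewrite scale0r addr0 subr0 Dg => E.
set D := 'd ('D_h f) x in dP.
have DD : D (c *: h + t *: v) = D (c *: h) + D (t *: v) by rewrite linearD.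
have Dv : D (t *: v) = t * D v by rewrite linearZ.
set p := 'D_h f (x + (c *: h + t *: v)) - 'D_h f x - D (c *: h + t *: v).
set q := 'D_h f (x + c *: h) - 'D_h f x - D (c *: h).
have -> : second_difference f x h v t = t * p - t * q + t ^+ 2 * D v.
  move: E; rewrite /second_difference /g /p /q DD Dv addrA.
  by move=> E; nra.
have hv : `|c *: h + t *: v| <= t * (`|h| + `|v|).
  rewrite mulrDr (le_trans (ler_normD _ _))// !normrZ !gtr0_norm//.
  by rewrite lerD// ler_wpM2r// ltW.
have hh : `|c *: h| <= t * `|h|.
  by rewrite normrZ gtr0_norm// ler_wpM2r// ltW.
have h0 : 0 <= t * `|h| by rewrite mulr_ge0// ltW.
have v0 : 0 <= t * `|v| by rewrite mulr_ge0// ltW.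
have td : t * (2 * `|h| + `|v|) < d by rewrite /C in tC; lra.
have eC : 0 < e / C by rewrite divr_gt0.
have pP : `|p| <= e / C * (t * (`|h| + `|v|)).
  by apply: le_trans (dP _ _) _; rewrite ?ler_pM2l//; lra.
have qP : `|q| <= e / C * (t * `|h|).
  by apply: le_trans (dP _ _) _; rewrite ?ler_pM2l//; lra.
rewrite deriveE// addrK (le_trans (ler_normB _ _))// !normrM gtr0_norm//.
have -> : e * t ^+ 2 = t * (e / C * (t * C)) by field; rewrite gt_eqF.
rewrite -mulrDr ler_pM2l// (le_trans (lerD pP qP))// -mulrDr ler_pM2l//.
by rewrite /C; lra.
Qed.

(** The second difference is symmetric in [h] and [v], and divided by $t^2$ it approximates either
    mixed derivative. *)
Lemma derive_comm f x h v :
  (forall y, differentiable f y) ->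
  differentiable ('D_h f) x -> differentiable ('D_v f) x ->
  'D_v ('D_h f) x = 'D_h ('D_v f) x :> R.
Proof.
move=> df dh dv; apply/eqP; rewrite -subr_eq0 -normr_le0.
apply/ler_addgt0Pl => e e0; rewrite addr0.
have e2 : 0 < e / 2 by rewrite divr_gt0.
have [d1 d10 P1] := second_difference_approx v df dh e2.
have [d2 d20 P2] := second_difference_approx h df dv e2.
pose t := Num.min d1 d2 / 2.
have m0 : 0 < Num.min d1 d2 by rewrite lt_min d10.
have t0 : 0 < t by rewrite divr_gt0.
have tm : t < Num.min d1 d2 by rewrite /t; lra.
have {}P1 := P1 t; have {}P2 := P2 t.
move: tm; rewrite lt_min => /andP[t1 t2].
rewrite t0 t1 in P1; rewrite t0 t2 in P2.
have := P1 isT; have := P2 isT.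
have -> : second_difference f x v h t = second_difference f x h v t.
  by rewrite /second_difference (addrAC x (t *: v)); ring.
move: (second_difference f x h v t) ('D_v ('D_h f) x) ('D_h ('D_v f) x) => S A A'.
have T0 : 0 < t ^+ 2 by rewrite exprn_gt0.
move: (t ^+ 2) T0 => T T0 h1 h2.
rewrite -(ler_pM2l T0) -[X in X * `|_|](gtr0_norm T0) -normrM.
have -> : T * (A - A') = (S - T * A') - (S - T * A) by ring.
apply: le_trans (ler_normB _ _) _; apply: le_trans (lerD h1 h2) _.
by have -> : e / 2 * T + e / 2 * T = T * e by field.
Qed.

(** * First- and second-order conditions for convex functions *)

Section Convex.
Variable f : U -> R.
Hypothesis cf : convex_function [set: U] f.
Hypothesis df : forall x, differentiable f x.

Lemma convex_combination_le x y (t : R) : 0 <= t <= 1 ->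
  f (t *: x + (1 - t) *: y) <= t * f x + (1 - t) * f y.
Proof.
move=> /andP[t0 t1].
have tP : Itv.spec (@Itv.num_sem R) (Itv.Real `[0%Z, 1%Z]) t.
  by rewrite /= /Itv.num_sem/= num_real/= in_itv/= t0 t1.
by apply: (cf (Itv.mk tP)); rewrite inE.
Qed.

Lemma convex_derive_le x y : f x + 'D_(y - x) f x <= f y.
Proof.
apply/ler_addgt0Pl => e e0.
pose C := `|y - x| + 1.
have C0 : 0 < C by rewrite ltr_wpDl.
have eC : 0 < e / C by rewrite divr_gt0.
have [d d0 dP] := differentiable_near (df x) eC.
pose t := Num.min 1 (d / C) / 2.
have m0 : 0 < Num.min 1 (d / C) by rewrite lt_min ltr01 divr_gt0.
have t0 : 0 < t by rewrite divr_gt0.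
have : t < Num.min 1 (d / C) by rewrite /t; lra.
rewrite lt_min ltr_pdivlMr// => /andP[t1 tC].
have td : `|t *: (y - x)| < d.
  by rewrite normrZ gtr0_norm// (le_lt_trans _ tC)// ler_pM2l// /C lerDl.
have := dP _ td; rewrite linearZ /= normrZ gtr0_norm// -deriveE//.
rewrite ler_norml => /andP[+ _].
have -> : x + t *: (y - x) = t *: y + (1 - t) *: x.
  by rewrite scalerBr scalerBl scale1r addrCA.
have := @convex_combination_le y x t; rewrite (ltW t0) (ltW t1) => /(_ isT).
have : e / C * (t * `|y - x|) <= t * e.
  rewrite mulrCA ler_pM2l// mulrAC ler_pdivrMr// ler_pM2l//.
  by rewrite /C lerDl.
rewrite /GRing.scale /=.
move=> h1 h2 h3; rewrite -(ler_pM2l t0); lra.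
Qed.

(** The gradient inequalities at $x$ and $x+th$ add up to $D_hf(x)\le D_hf(x+th)$, which is compared
    with the first-order expansion of ['D_h f]. *)
Lemma convex_derive2_ge0 x h : differentiable ('D_h f) x ->
  0 <= 'D_h ('D_h f) x.
Proof.
move=> dh; apply/ler_addgt0Pl => e e0.
pose C := `|h| + 1.
have C0 : 0 < C by rewrite ltr_wpDl.
have eC : 0 < e / C by rewrite divr_gt0.
have [d d0 dP] := differentiable_near dh eC.
pose t := d / C / 2.
have t0 : 0 < t by rewrite !divr_gt0.
have tC : t * C < d by rewrite /t mulrAC divfK ?gt_eqF//; lra.
have td : `|t *: h| < d.
  by rewrite normrZ gtr0_norm// (le_lt_trans _ tC)// ler_pM2l// /C lerDl.
have := dP _ td; rewrite linearZ /= normrZ gtr0_norm// -deriveE//.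
rewrite ler_norml => /andP[_].
have := convex_derive_le x (x + t *: h).
have := convex_derive_le (x + t *: h) x.
rewrite opprD addNKr addrAC subrr add0r -scaleNr !deriveZv// => h1 h2.
have h3 : 'D_h f x <= 'D_h f (x + t *: h) by nra.
have : e / C * (t * `|h|) <= t * e.
  rewrite mulrCA ler_pM2l// mulrAC ler_pdivrMr// ler_pM2l//.
  by rewrite /C lerDl.
rewrite /GRing.scale /=.
move=> h4 h5; rewrite -(ler_pM2l t0); lra.
Qed.

End Convex.
End DirectionalDerivatives.

(** * Hoelder smoothness and Taylor bounds *)

Section Smoothness.
Context (R : realType) (V : vectType R) (B : metric_op V).
Local Notation E := (euclid B).
Implicit Types (f : E -> R) (x y h v : E).

Lemma L_const_differentiable f p nu :
  (L_const f p nu < +oo)%E -> times_differentiable p f.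
Proof. by rewrite /L_const; case: asboolP => //; rewrite ltxx. Qed.

Lemma L_const_le f p nu (hs : p.-tuple E) x y :
  (L_const f p nu < +oo)%E -> (forall i, `|tnth hs i| <= 1) -> x != y ->
  Dform f hs x - Dform f hs y <= fine (L_const f p nu) * `|x - y| `^ nu.
Proof.
move=> Lfin hs1 xy.
have : ((Dform f hs x - Dform f hs y)%:E * ((`|x - y| `^ nu)^-1)%:E
     <= L_const f p nu)%E.
  move: Lfin; rewrite /L_const; case: asboolP => // _ _.
  apply: ereal_sup_ge; exists (form_norm (fun h : p.-tuple E =>
      (Dform f h x - Dform f h y)%R) * ((`|x - y| `^ nu)^-1)%:E)%E.
    by exists (x, y).
  apply: lee_wpmul2r; first by rewrite lee_fin invr_ge0 powR_ge0.
  by apply: ereal_sup_ubound; exists hs.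
have n0 : 0 < `|x - y| `^ nu by rewrite powR_gt0// normr_gt0 subr_eq0.
rewrite -EFinM; move: Lfin; case: (L_const f p nu) => //= r _.
by rewrite lee_fin ler_pdivrMr.
Qed.

Lemma L_const_ge0 f p nu :
  (exists x y : E, x != y) ->
  (L_const f p nu < +oo)%E -> 0 <= fine (L_const f p nu).
Proof.
move=> [x [y xy]] Lfin.
have n0 : 0 < `|x - y| `^ nu by rewrite powR_gt0// normr_gt0 subr_eq0.
pose z := [tuple (0 : E) | i < p].
have h : forall i, `|tnth z i| <= 1 by move=> i; rewrite tnth_mktuple normr0.
have h1 := L_const_le Lfin h xy.
have xy' : y != x by rewrite eq_sym.
have h2 := L_const_le Lfin h xy'; rewrite distrC in h2.
by rewrite -(pmulr_lge0 _ n0) mulrC; lra.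
Qed.

Hypothesis E2 : exists x y : E, x != y.

Lemma unit_vectorE h : exists2 u : E, `|u| <= 1 & h = `|h| *: u.
Proof.
have [->|h0] := eqVneq h 0; first by exists 0; rewrite ?normr0// scaler0.
have h1 : `|h| != 0 by rewrite normr_eq0.
exists (`|h|^-1 *: h).
  by rewrite normrZ normfV normr_id mulVf.
by rewrite scalerA divff// scale1r.
Qed.

(** [form_norm] tests vectors of norm at most one, so [h] is scaled to [u] and its length returns by
    homogeneity. *)
Lemma hessian_holder f nu x y h v :
  (L_const f 2 nu < +oo)%E -> `|v| <= 1 ->
  'D_h ('D_v f) x - 'D_h ('D_v f) y
    <= fine (L_const f 2 nu) * `|h| * `|x - y| `^ nu.
Proof.
move=> Lfin v1; have L0 := L_const_ge0 E2 Lfin.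
have [->|xy] := eqVneq x y; first by rewrite subrr !mulr_ge0// powR_ge0.
have [_ /(_ v)[dv _]] := L_const_differentiable Lfin.
have [u u1 hu] := unit_vectorE h.
have Dh z : 'D_h ('D_v f) z = `|h| * 'D_u ('D_v f) z by rewrite {1}hu deriveZv.
rewrite !Dh -mulrBr mulrAC mulrC ler_wpM2r//.
apply: (L_const_le (hs := [tuple u; v])) => // i.
by rewrite (tnth_nth 0); case: i => -[|[|]].
Qed.

Lemma third_derivative_holder f nu x y h v :
  (L_const f 3 nu < +oo)%E -> `|v| <= 1 ->
  'D_v ('D_h ('D_h f)) x - 'D_v ('D_h ('D_h f)) y
    <= fine (L_const f 3 nu) * `|h| ^+ 2 * `|x - y| `^ nu.
Proof.
move=> Lfin v1; have L0 := L_const_ge0 E2 Lfin.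
have [->|xy] := eqVneq x y.
  by rewrite subrr !mulr_ge0// ?sqr_ge0// powR_ge0.
have [df d2f] := L_const_differentiable Lfin.
have [u u1 hu] := unit_vectorE h.
have Dhu g z : differentiable g z -> 'D_h g z = `|h| * 'D_u g z.
  by move=> dg; rewrite {1}hu deriveZv.
have Dh : 'D_h f = `|h| \*: 'D_u f :> (E -> R).
  by apply/funext => z; rewrite Dhu.
have Ds (g g' : E -> R) (c : R) w z : differentiable g' z -> g = c \*: g' ->
    'D_w g z = c * 'D_w g' z.
  by move=> dg' ->; rewrite deriveZ//; exact: diff_derivable.
have [du /(_ u)[ddu _]] := d2f u.
have DDh : 'D_h ('D_h f) = (`|h| ^+ 2) \*: 'D_u ('D_u f) :> (E -> R).
  apply/funext => z; rewrite (Ds _ _ _ h z (du z) Dh) expr2 (Dhu _ _ (du z)).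
  exact: mulrA.
have Dvh z := Ds _ _ _ v z (ddu z) DDh.
rewrite (Dvh x) [X in _ - X](Dvh y).
rewrite -mulrBr [leRHS]mulrAC [leRHS]mulrC.
apply: ler_wpM2l; first exact: sqr_ge0.
apply: (L_const_le (hs := [tuple v; u; u])) => // i.
by rewrite (tnth_nth 0); case: i => -[|[|[|]]].
Qed.

Lemma hessian_taylor f nu x h v :
  (L_const f 2 nu < +oo)%E -> 0 <= nu -> `|v| <= 1 ->
  'D_v f (x + h) - 'D_v f x - 'D_h ('D_v f) x
    <= fine (L_const f 2 nu) * `|h| * `|h| `^ nu.
Proof.
move=> Lfin nu0 v1; have L0 := L_const_ge0 E2 Lfin.
have [df /(_ v)[dv _]] := L_const_differentiable Lfin.
have [c /andP[c0 c1] ->] := MVT_line1 x h dv.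
apply: le_trans (hessian_holder _ _ _ Lfin v1) _.
rewrite ler_wpM2l ?mulr_ge0// ge0_ler_powR// ?nnegrE//.
by rewrite addrC addKr normrZ gtr0_norm// ler_piMl// ltW.
Qed.

Let le_div_of_sub_eq (a b k tau : R) : 0 < tau ->
  a - b = - k * tau -> 0 <= a -> k <= b / tau.
Proof. by move=> tau0 abk a0; rewrite ler_pdivlMr//; lra. Qed.

(** In use, [c] is a mean value parameter and [k1], [k2], [k3] are third derivatives at three
    points; [k1] is telescoped through [k2] to [k3], the one that convexity bounds. *)
Let remainder_le (a b d r c A C1 C2 k1 k2 k3 : R) : 0 <= c -> c <= 1 ->
  a - b = r -> r - d = k1 * c -> 0 <= A -> 0 <= C1 -> 0 <= C2 ->
  k3 <= A -> k2 - k3 <= C1 -> k1 - k2 <= C2 ->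
  a - b - d <= A + (C1 + C2).
Proof.
move=> c0 c1 -> -> A0 C10 C20 k3A k23 k12.
apply: (@le_trans _ _ ((A + (C1 + C2)) * c)); first by rewrite ler_wpM2r//; lra.
by rewrite ler_piMr// !addr_ge0.
Qed.

(* Convexity of [f] gives [D^2 f(x - tau v)[h, h] >= 0], so that the third
   derivative [D^3 f(x)[v, h, h]] is at most [D^2 f(x)[h, h] / tau] up to the
   Hoelder error; this controls the quadratic Taylor term without a bound on
   the third derivative itself. *)
Lemma third_taylor f nu x h v (tau : R) :
  convex_function [set: E] f ->
  (L_const f 3 nu < +oo)%E -> 0 <= nu -> `|v| <= 1 -> 0 < tau ->
  'D_v f (x + h) - 'D_v f x - 'D_h ('D_v f) x
    <= 'D_h ('D_h f) x / tau
       + fine (L_const f 3 nu) * `|h| ^+ 2 * (tau `^ nu + `|h| `^ nu).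
Proof.
move=> cf Lfin nu0 v1 tau0; have L0 := L_const_ge0 E2 Lfin.
have [df d2f] := L_const_differentiable Lfin.
have [dh /(_ h)[dhh _]] := d2f h.
have [dv /(_ h)[dhv _]] := d2f v.
have [_ /(_ v)[dvh _]] := d2f h.
have comm (g : E -> R) z : (forall y, differentiable g y) ->
    differentiable ('D_v g) z -> differentiable ('D_h g) z ->
    'D_h ('D_v g) z = 'D_v ('D_h g) z.
  by move=> *; exact: derive_comm.
(* Two exchanges move [v] outermost: one for [f], one for ['D_h f]. *)
have swap z : 'D_h ('D_h ('D_v f)) z = 'D_v ('D_h ('D_h f)) z.
  have Deq (g g' : E -> R) : g = g' -> 'D_h g z = 'D_h g' z by move=> ->.
  have hv : 'D_h ('D_v f) = 'D_v ('D_h f) :> (E -> R).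
    by apply/funext => y; exact: comm _ _ df (dv y) (dh y).
  have Dswap := comm _ z dh (dvh z) (dhh z).
  have Dhv := Deq _ _ hv.
  by have := etrans Dhv Dswap.
(* Nested mean values: [c] for ['D_v f] between $x$ and $x+h$, then [e] for its derivative along [h]
   between $x$ and $x+ch$. *)
have [c /andP[c0 c1] Ec] := MVT_line1 x h dv.
have [e /andP[e0 ec] Ee] := MVT_line0 x h dhv c0.
rewrite swap in Ee.
have DN (g : E -> R) y : differentiable g y -> 'D_(- v) g y = - 'D_v g y.
  by move=> dg; rewrite -scaleN1r deriveZv// mulN1r.
pose T := 'D_h ('D_h f); pose kap := 'D_v T.
(* A mean value between $x$ and $x-\tau v$: since [T] is nonnegative at the far end, [kap] at $x-av$
   is at most $T(x)/\tau$. *)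
have [a /andP[a0 atau]] := MVT_line0 x (- v) dhh tau0.
rewrite (DN _ _ (dhh _)) -/T -/kap => E1.
have T0 := convex_derive2_ge0 cf df (dh (x + tau *: - v)).
have T0' := convex_derive2_ge0 cf df (dh x).
have h1 : kap (x + a *: - v) <= T x / tau.
  exact: le_div_of_sub_eq tau0 E1 T0.
have h2 : kap x - kap (x + a *: - v)
    <= fine (L_const f 3 nu) * `|h| ^+ 2 * tau `^ nu.
  apply: le_trans (third_derivative_holder _ _ _ Lfin v1) _.
  have xa : `|x - (x + a *: - v)| <= tau.
    rewrite opprD addrA subrr add0r scalerN opprK normrZ gtr0_norm//.
    by rewrite (le_trans _ (ltW atau))// ler_piMr// ltW.
  by rewrite ler_wpM2l ?mulr_ge0 ?sqr_ge0// ge0_ler_powR// ?nnegrE// ltW.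
have h3 : kap (x + e *: h) - kap x
    <= fine (L_const f 3 nu) * `|h| ^+ 2 * `|h| `^ nu.
  apply: le_trans (third_derivative_holder _ _ _ Lfin v1) _.
  rewrite ler_wpM2l ?mulr_ge0 ?sqr_ge0// ge0_ler_powR// ?nnegrE//.
  rewrite addrC addKr normrZ gtr0_norm// ler_piMl//.
  by rewrite ltW// (lt_trans ec).
rewrite mulrDr; apply: (remainder_le (ltW c0) (ltW c1) Ec Ee _ _ _ h1 h2 h3).
- by rewrite divr_ge0// ltW.
- by rewrite !mulr_ge0 ?sqr_ge0// powR_ge0.
- by rewrite !mulr_ge0 ?sqr_ge0// powR_ge0.
Qed.

End Smoothness.

(** * The regularized Newton step *)

Section NewtonStep.
Context (R : realType) (V : vectType R) (B : metric_op V).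
Local Notation E := (euclid B).
Local Notation E' := 'Hom(euclid B, R).
Implicit Types (x y z h v : E) (s : E') (psi phi : E -> \bar R).

(** The passage $t\to0$, used for the optimality condition of the Newton point and for approaching
    the ends of a segment. *)
Lemma ge0_of_ge0_addM (a c : R) :
  (forall t, 0 < t <= 1 -> 0 <= a + t * c) -> 0 <= a.
Proof.
move=> H; apply/ler_addgt0Pl => e e0.
pose t := Num.min 1 (e / (`|c| + 1)).
have c0 : 0 < `|c| + 1 by rewrite ltr_wpDl.
have t0 : 0 < t by rewrite lt_min ltr01 divr_gt0.
have t1 : t <= 1 by rewrite ge_min lexx.
have te : t * (`|c| + 1) <= e by rewrite -ler_pdivlMr// ge_min lexx orbT.
have := H t; rewrite t0 t1 => /(_ isT).
have : t * c <= t * `|c| by rewrite ler_pM2l// ler_norm.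
lra.
Qed.

Lemma proper_edom_fin psi x : (forall y, psi y != -oo%E) -> edom psi x ->
  exists a, psi x = a%:E.
Proof.
by move=> /(_ x); rewrite /edom /=; case: (psi x) => // r; exists r.
Qed.

Lemma subdiff_monotone phi x y s s' : (forall z, phi z != -oo%E) ->
  subdiff phi x s -> subdiff phi y s' -> 0 <= (s - s') (x - y).
Proof.
move=> phiN [dx sx] [dy sy].
have [a ax] := proper_edom_fin phiN dx.
have [b bx] := proper_edom_fin phiN dy.
have := sx y; have := sy x; rewrite ax bx -!EFinD !lee_fin.
rewrite !lfunE/= lfunE/= -[y - x]opprB linearN; lra.
Qed.

Lemma closed_convex_le psi x y (a b t : R) : proper_closed_convex psi ->
  psi x = a%:E -> psi y = b%:E -> 0 <= t <= 1 ->
  (psi (t *: x + (1 - t) *: y)%R <= (t * a + (1 - t) * b)%:E)%E.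
Proof.
move=> [_ _ _ cepi] xa yb /andP[t0 t1].
have tP : Itv.spec (@Itv.num_sem R) (Itv.Real `[0%Z, 1%Z]) t.
  by rewrite /= /Itv.num_sem/= num_real/= in_itv/= t0 t1.
have := cepi (x, a) (y, b) (Itv.mk tP); rewrite !inE /epigraph /= xa yb !lexx.
by move=> /(_ isT isT).
Qed.

Section Model.
Variable f : E -> R.
Hypothesis f2 : times_differentiable 2 f.

Let df x : differentiable f x. Proof. by case: f2. Qed.
Let d2f v x : differentiable ('D_v f) x. Proof. by case: f2 => _ /(_ v)[]. Qed.

Lemma gradE x v : grad f x v = 'D_v f x.
Proof. by rewrite /grad lfunE deriveE. Qed.

Lemma second_derivative_linear x h : linear (fun v => 'D_h ('D_v f) x).
Proof.
move=> a u v.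
have -> : 'D_(a *: u + v) f = (a \*: 'D_u f) + 'D_v f :> (E -> R).
  by apply/funext => z; rewrite derive_linear.
have du w : derivable ('D_w f) x h by exact: diff_derivable.
by rewrite deriveD ?deriveZ//; exact: derivableZ.
Qed.

(** [linfun] is guaranteed to agree with a function only when that function is linear, hence the
    appeal to [second_derivative_linear]. *)
Lemma hessE x h v : hess f x h v = 'D_h ('D_v f) x.
Proof.
pose L : {linear E -> R} := HB.pack (fun v => 'D_h ('D_v f) x)
  (GRing.isLinear.Build _ _ _ _ _ (second_derivative_linear x h)).
exact: (lfunE L).
Qed.

Lemma hessC x h v : hess f x h v = hess f x v h.
Proof. by rewrite !hessE; apply: derive_comm. Qed.

Lemma hessDr x h u v : hess f x h (u + v) = hess f x h u + hess f x h v.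
Proof. exact: linearD. Qed.

Lemma hessZr x h a v : hess f x h (a *: v) = a * hess f x h v.
Proof. exact: linearZ. Qed.

Lemma hessDl x h u v : hess f x (u + v) h = hess f x u h + hess f x v h.
Proof. by rewrite [LHS]hessC [LHS]hessDr; congr (_ + _); exact: hessC. Qed.

Lemma hessZl x h a v : hess f x (a *: v) h = a * hess f x v h.
Proof. by rewrite [LHS]hessC [LHS]hessZr; congr (_ * _); exact: hessC. Qed.

Definition quad_model x (lambda : R) h : R :=
  grad f x h + 2^-1 * hess f x h h + lambda / 2 * `|h| ^+ 2.

Lemma newton_modelE psi x lambda y :
  newton_model f psi x lambda y = ((quad_model x lambda (y - x))%:E + psi y)%E.
Proof. by []. Qed.

Let bilinear_expand (b : E -> E -> R) h d (t : R) :
  (forall u v w, b (u + v) w = b u w + b v w) ->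
  (forall u v w, b w (u + v) = b w u + b w v) ->
  (forall a u v, b (a *: u) v = a * b u v) ->
  (forall a u v, b v (a *: u) = a * b v u) ->
  (forall u v, b u v = b v u) ->
  b (h + t *: d) (h + t *: d) = b h h + 2 * t * b h d + t ^+ 2 * b d d.
Proof. by move=> Dl Dr Zl Zr C; rewrite Dl !Dr !Zl !Zr (C d h); ring. Qed.

Let quad_expand (l l0 l1 b b0 b1 b2 n n0 n1 n2 lambda t : R) :
  l = l0 + t * l1 -> b = b0 + 2 * t * b1 + t ^+ 2 * b2 ->
  n = n0 + 2 * t * n1 + t ^+ 2 * n2 ->
  l + 2^-1 * b + lambda / 2 * n = l0 + 2^-1 * b0 + lambda / 2 * n0
    + t * (l1 + b1 + lambda * n1) + t ^+ 2 * (2^-1 * b2 + lambda / 2 * n2).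
Proof. by move=> -> -> ->; field. Qed.

Lemma sqr_normD h d (t : R) :
  `|h + t *: d| ^+ 2 = `|h| ^+ 2 + 2 * t * B h d + t ^+ 2 * `|d| ^+ 2.
Proof.
rewrite !sqr_euclid_norm; apply: (@bilinear_expand (fun u v => B u v)) => *.
- exact: metricDl.
- exact: metricDr.
- exact: metricZl.
- exact: metricZr.
- exact: metric_selfadjoint.
Qed.

Lemma hessD x h d (t : R) : hess f x (h + t *: d) (h + t *: d)
  = hess f x h h + 2 * t * hess f x h d + t ^+ 2 * hess f x d d.
Proof.
apply: (@bilinear_expand (fun u v => hess f x u v)) => *.
- exact: hessDl.
- exact: hessDr.
- exact: hessZl.
- exact: hessZr.
- exact: hessC.
Qed.

Lemma quad_modelD x lambda h d (t : R) :
  quad_model x lambda (h + t *: d) = quad_model x lambda h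
    + t * (grad f x d + hess f x h d + lambda * B h d)
    + t ^+ 2 * (2^-1 * hess f x d d + lambda / 2 * `|d| ^+ 2).
Proof.
have gradD : grad f x (h + t *: d) = grad f x h + t * grad f x d.
  by rewrite linearD linearZ.
exact: quad_expand gradD (hessD x h d t) (sqr_normD h d t).
Qed.

Lemma comp_gradE x s v : comp_grad f x s v = grad f x v + s v.
Proof. exact: add_lfunE. Qed.

Lemma newton_subgradE x lambda z v : newton_subgrad f x lambda z v =
  - (grad f x v + hess f x (z - x) v + lambda * B (z - x) v).
Proof.
rewrite /newton_subgrad !(add_lfunE, opp_lfunE, scale_lfunE) /GRing.scale /=.
by rewrite !opprD.
Qed.

Let first_order_step (a b m l c t : R) : 0 < t ->
  m + b <= m + t * l + t ^+ 2 * c + (t * a + (1 - t) * b) ->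
  0 <= a - (b + - l) + t * c.
Proof. by move=> t0 h; rewrite -(pmulr_rge0 _ t0); lra. Qed.

(** The Newton point is compared with $z+t(y-z)$: the smooth part changes by a quadratic polynomial
    in [t], while [psi] stays below its chord. Dividing by [t] and letting $t\to0$ leaves the
    subgradient inequality. *)
Lemma newton_subgrad_subdiff psi x (lambda : R) z :
  proper_closed_convex psi -> edom psi x ->
  is_newton_point f psi x lambda z ->
  subdiff psi z (newton_subgrad f x lambda z).
Proof.
move=> cpsi domx zmin; have [psiN _ _ _] := cpsi.
have [c xc] := proper_edom_fin psiN domx.
have domz : edom psi z.
  have := zmin x; rewrite !newton_modelE xc /edom /= -EFinD.
  by case: (psi z) => [r _| |_]; rewrite ?ltry ?ltNyr.
have [b zb] := proper_edom_fin psiN domz.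
split => // y; case E : (psi y) => [a| |]; last 2 first.
- by rewrite leey.
- by move: (psiN y); rewrite E.
rewrite zb -EFinD lee_fin newton_subgradE -subr_ge0.
apply: (@ge0_of_ge0_addM _ (2^-1 * hess f x (y - z) (y - z)
  + lambda / 2 * `|y - z| ^+ 2)) => t /andP[t0 t1].
have t01 : 0 <= t <= 1 by rewrite ltW.
have h1 := closed_convex_le cpsi E zb t01.
have := zmin (t *: y + (1 - t) *: z); rewrite !newton_modelE.
have -> : t *: y + (1 - t) *: z - x = (z - x) + t *: (y - z).
  rewrite scalerBl scalerBr scale1r addrCA -addrA [RHS]addrAC -!addrA.
  by congr (_ + _); rewrite addrC.
move=> /le_trans /(_ (leeD2l _ h1)).
rewrite zb -!EFinD lee_fin quad_modelD => h2.
exact: first_order_step t0 h2.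
Qed.

Let step_bound (l b m c d lambda : R) : 0 <= - (l + b + lambda * m) - d ->
  - (l + d) <= c -> b + lambda * m <= c.
Proof. lra. Qed.

(** Monotonicity of the subdifferential of [psi] between [z] and [x], with the explicit subgradient
    at [z]; what remains is the pairing of $F'(x)$ with $x-z$. *)
Lemma newton_step_bound psi x (lambda : R) z s :
  (forall y, psi y != -oo%E) -> subdiff psi x s ->
  subdiff psi z (newton_subgrad f x lambda z) ->
  hess f x (z - x) (z - x) + lambda * `|z - x| ^+ 2
    <= dual_norm (comp_grad f x s) * `|z - x|.
Proof.
move=> psiN sx sz; have := subdiff_monotone psiN sz sx.
rewrite add_lfunE opp_lfunE newton_subgradE => h1.
have := le_dual_norm (comp_grad f x s) (- (z - x)).
rewrite normrN linearN /= comp_gradE sqr_euclid_norm.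
exact: step_bound h1.
Qed.

Let residual_algebra (u w wh h lambda : R) : 0 < lambda -> 0 <= w ->
  u <= lambda ^+ 2 * h -> u = w + 2 * lambda * wh + lambda ^+ 2 * h ->
  w <= - wh * (4 * lambda).
Proof. by move=> l0 w0 h1 uE; lra. Qed.

(** Let [u] represent the Taylor residual of the gradient and $h=z-x$. Then $w=u-\lambda h$
    represents $F'(z)$, and squaring $\|u\|\le\lambda\|h\|$ gives $\|w\|^2\le-2\lambda\langle
    Bw,h\rangle$, which implies acceptance with a factor two to spare. *)
Lemma accepted_of_residual x (lambda : R) z : 0 < lambda ->
  (forall v, `|v| <= 1 ->
    'D_v f z - 'D_v f x - 'D_(z - x) ('D_v f) x <= lambda * `|z - x|) ->
  accepted f x lambda z.
Proof.
move=> l0 resle; rewrite /accepted /=.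
set F' := comp_grad _ _ _; set h := z - x.
have [u Bu nu] := metric_surj (grad f z - grad f x - hess f x h).
have nu1 : `|u| <= lambda * `|h|.
  rewrite -nu; have [v v1 ->] :=
    dual_norm_attained (grad f z - grad f x - hess f x h).
  by rewrite !(add_lfunE, opp_lfunE) !gradE hessE; exact: resle.
pose w : E := u - lambda *: h.
have F'w v : F' v = B w v.
  have -> : B w v = B u v - lambda * B h v by rewrite metricBl metricZl.
  rewrite [LHS]comp_gradE newton_subgradE -/h Bu.
  by rewrite !(add_lfunE, opp_lfunE); ring.
have -> : F' = (B w : E') by apply/lfunP => v; rewrite F'w.
rewrite dual_norm_metric sqr_euclid_norm -opprB linearN /= -/h.
have h1 : B u u <= lambda ^+ 2 * B h h.
  by rewrite -!sqr_euclid_norm -exprMn lerXn2r ?nnegrE ?mulr_ge0// ltW.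
have := sqr_normD w h lambda; rewrite subrK !sqr_euclid_norm => uE.
rewrite mulrC ler_pdivrMr ?mulr_gt0//.
exact: (residual_algebra l0 (metric_ge0 w) h1 uE).
Qed.

Hypothesis cf : convex_function [set: E] f.

Lemma hess_ge0 x h : 0 <= hess f x h h.
Proof. by rewrite hessE convex_derive2_ge0. Qed.

(** The Hessian is nonnegative by convexity, so the smooth part is at least
    $\frac\lambda2\|h\|^2-\|\nabla f(x)\|_*\|h\|$. *)
Lemma newton_point_exists psi x (lambda : R) s :
  proper_closed_convex psi -> subdiff psi x s -> 0 < lambda ->
  exists z, is_newton_point f psi x lambda z.
Proof.
move=> cpsi sx l0.
have l2 : 0 < lambda / 2 by rewrite divr_gt0.
have hess_cont : continuous (fun h : E => hess f x h h).
  apply: (@bilinear_diag_continuous _ _ _ (fun u v => hess f x u v)) => h a u v.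
    exact: linearP.
  by rewrite [LHS]hessDl; congr (_ + _); exact: hessZl.
have cstC (a : R) z : {for z, continuous (fun=> a : R)}.
  by move=> A; exact: (@cst_continuous E R a z A).
apply: (@exists_min_add_epigraph _ _ _ psi
  (fun y => quad_model x lambda (y - x)) x s
  (dual_norm (grad f x)) (lambda / 2)) => //.
- move=> y; apply: (@continuous_comp _ _ _ (fun y => y - x) (quad_model x lambda)).
    apply: continuousB; first exact: cvg_id.
    by move=> A; exact: (@cst_continuous _ _ x y A).
  apply: continuousD; last first.
    apply: continuousM; first exact: cstC.
    have nC : {for y - x, continuous (fun h : E => `|h|)} by exact: norm_continuous.
    exact: (continuousM nC nC).
  apply: continuousD.
    exact: (@linear_euclid_continuous R V B R (grad f x) (y - x)).
  apply: continuousM; first exact: cstC.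
  exact: hess_cont.
- by rewrite subrr /quad_model !linear0 normr0 expr0n /= !mulr0 !addr0.
- move=> y; rewrite /quad_model lerD2r.
  have := hess_ge0 x (y - x).
  have := le_dual_norm (grad f x) (- (y - x)); rewrite normrN linearN /=; lra.
Qed.

End Model.
End NewtonStep.

(** * Acceptance of large regularization parameters *)

Section Acceptance.
Context (R : realType) (V : vectType R) (B : metric_op V).
Local Notation E := (euclid B).
Local Notation E' := 'Hom(euclid B, R).
Variables (f : E -> R) (psi : E -> \bar R).
Hypothesis cf : convex_function [set: E] f.
Hypothesis f2 : times_differentiable 2 f.
Hypothesis cpsi : proper_closed_convex psi.
Hypothesis E2 : exists x y : E, x != y.

Let residual_le2 (M r u lambda nu : R) : 0 <= M -> 0 <= nu -> 0 <= r -> r <= u ->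
  6 * M * u `^ nu <= lambda -> M * r * r `^ nu <= lambda * r.
Proof.
move=> M0 nu0 r0 ru le.
have h : r `^ nu <= u `^ nu.
  by rewrite ge0_ler_powR// nnegrE// (le_trans r0).
rewrite mulrAC ler_wpM2r// (le_trans (ler_wpM2l M0 h))// (le_trans _ le)//.
by rewrite ler_wpM2r ?powR_ge0//; lra.
Qed.

(* [third_taylor] is applied with [tau = 2 g / lambda], and
   [theta = D^2 f(x)[h, h] <= g r] by the optimality of the Newton point. *)
Let residual_le3 (M r theta g lambda nu : R) : 0 <= M -> 0 <= nu <= 1 ->
  0 <= r -> 0 < g -> 0 < lambda -> theta <= g * r -> r <= g / lambda ->
  6 * M * (g / lambda) `^ (nu + 1) <= lambda ->
  theta / (2 * (g / lambda)) + M * r ^+ 2 * ((2 * (g / lambda)) `^ nu + r `^ nu)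
    <= lambda * r.
Proof.
move=> M0 /andP[nu0 nu1] r0 g0 l0 tgr ru le.
set u := g / lambda in ru le *.
have u0 : 0 < u by rewrite divr_gt0.
have h1 : theta / (2 * u) <= lambda * r / 2.
  have u2 : 0 < 2 * u by rewrite mulr_gt0.
  rewrite ler_pdivrMr// (le_trans tgr)// /u.
  by have -> : lambda * r / 2 * (2 * (g / lambda)) = g * r by field; rewrite gt_eqF.
have h2 : (2 * u) `^ nu <= 2 * u `^ nu.
  rewrite powRM ?(ltW u0)// ler_wpM2r ?powR_ge0//.
  by rewrite ler1_powR// ler1n.
have h3 : r `^ nu <= u `^ nu by rewrite ge0_ler_powR// nnegrE// ltW.
have h4 : M * r ^+ 2 * ((2 * u) `^ nu + r `^ nu) <= M * r * u * (3 * u `^ nu).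
  rewrite ler_pM ?addr_ge0 ?powR_ge0 ?mulr_ge0 ?sqr_ge0//; last by lra.
  by rewrite expr2 mulrA ler_wpM2l// mulr_ge0.
have h5 : M * r * u * (3 * u `^ nu) <= lambda * r / 2.
  have -> : M * r * u * (3 * u `^ nu) = r / 2 * (6 * M * u `^ (nu + 1)).
    rewrite powRD; last by rewrite (gt_eqF u0) implybT.
    by rewrite powRr1 ?(ltW u0)//; field.
  have -> : lambda * r / 2 = r / 2 * lambda by ring.
  by rewrite ler_wpM2l// divr_ge0.
lra.
Qed.

(** For $q<3$ the Hessian is Hoelder with exponent $q-2$. For $q\ge3$ the third derivative is, with
    exponent $q-3$, and one more factor $\|h\|$ in its Taylor bound restores $q-2$. *)
Lemma accepted_of_lambda_ge (q lambda : R) x s z :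
  2 < q <= 4 -> (M_const f q < +oo)%E -> subdiff psi x s ->
  let g := dual_norm (comp_grad f x s) in
  0 < g -> 0 < lambda -> is_newton_point f psi x lambda z ->
  6 * fine (M_const f q) * (g / lambda) `^ (q - 2) <= lambda ->
  accepted f x lambda z.
Proof.
move=> /andP[q2 q4] Mfin sx g g0 l0 zmin le; have [psiN _ _ _] := cpsi.
have domx : edom psi x by case: sx.
have sz := newton_subgrad_subdiff f2 cpsi domx zmin.
have bound := newton_step_bound psiN sx sz; rewrite -/g in bound.
set h := z - x in bound *.
have h0 := hess_ge0 f2 cf x h.
have r0 : 0 <= `|h| by [].
have hgr : hess f x h h <= g * `|h|.
  by rewrite (le_trans _ bound)// lerDl mulr_ge0// ?ltW// sqr_ge0.
have ru : `|h| <= g / lambda.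
  rewrite ler_pdivlMr//; have [->|hn0] := eqVneq h 0.
    by rewrite normr0 mul0r ltW.
  have hn : 0 < `|h| by rewrite normr_gt0.
  rewrite -(ler_pM2l hn) mulrA -expr2 [leLHS]mulrC [leRHS]mulrC.
  by rewrite (le_trans _ bound)// lerDr.
apply: accepted_of_residual => // v v1; rewrite -/h.
have zE : z = x + h by rewrite addrC subrK.
rewrite zE; move: Mfin le; rewrite /M_const; case: ifPn => q3 Mfin le.
  have nu0 : 0 <= q - 2 by lra.
  apply: le_trans (hessian_taylor E2 x h Mfin nu0 v1) _.
  exact: residual_le2 (L_const_ge0 E2 Mfin) nu0 r0 ru le.
have nu0 : 0 <= q - 3 <= 1 by lra.
have nu00 : 0 <= q - 3 by lra.
have tau0 : 0 < 2 * (g / lambda) by rewrite mulr_gt0// divr_gt0.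
apply: le_trans (third_taylor E2 x h cf Mfin nu00 v1 tau0) _.
rewrite -hessE//; apply: residual_le3 (L_const_ge0 E2 Mfin) nu0 r0 g0 l0 hgr ru _.
by have -> : q - 3 + 1 = q - 2 by lra.
Qed.

(** Multiplying by $\lambda^{q-2}$ gives $\lambda^{q-1}\le6Mg^{q-2}$; then a root of order $q-1$ is
    taken. *)
Lemma lambda_le_of_rejected (q lambda g M : R) : 2 <= q -> 0 < lambda -> 0 < g ->
  0 <= M -> lambda <= 6 * M * (g / lambda) `^ (q - 2) ->
  lambda <= (6 * M) `^ (1 / (q - 1)) * g `^ ((q - 2) / (q - 1)).
Proof.
move=> q2 l0 g0 M0 le.
have q1 : 0 < q - 1 by lra.
have -> : lambda = (lambda `^ (q - 1)) `^ (1 / (q - 1)).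
  by rewrite -powRrM mul1r divff ?gt_eqF// powRr1// ltW.
have -> : (q - 2) / (q - 1) = (q - 2) * (1 / (q - 1)) by field; rewrite gt_eqF.
rewrite powRrM -powRM ?mulr_ge0 ?powR_ge0//.
apply: ge0_ler_powR; rewrite ?nnegrE ?mulr_ge0 ?powR_ge0//.
  by rewrite invr_ge0 ltW.
have -> : q - 1 = q - 2 + 1 by ring.
rewrite powRD; last by rewrite (gt_eqF l0) implybT.
rewrite powRr1 ?(ltW l0)//.
have l1 : 0 < lambda `^ (q - 2) by rewrite powR_gt0.
rewrite -(ler_pM2l l1) in le; apply: (le_trans le).
rewrite mulrCA -powRM ?divr_ge0 ?(ltW l0) ?(ltW g0)//.
by rewrite [lambda * _]mulrC divfK ?gt_eqF.
Qed.

End Acceptance.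

(** * Uniform convexity on the sublevel set *)

Lemma conv_subr (R : pzRingType) (W : lmodType R) (x y : W) (t : R) :
  t *: x + (1 - t) *: y - y = t *: (x - y).
Proof. by rewrite scalerBl scale1r scalerBr -addrA addrAC subrr add0r. Qed.

Lemma conv_subl (R : pzRingType) (W : lmodType R) (x y : W) (t : R) :
  t *: x + (1 - t) *: y - x = (1 - t) *: (y - x).
Proof. by rewrite -(conv_subr y x (1 - t)) subKr; congr (_ - _); exact: addrC. Qed.

Section RelativeSize.
Context (R : realType) (V : vectType R) (B : metric_op V).
Local Notation E := (euclid B).
Local Notation E' := 'Hom(euclid B, R).
Variables (phi : E -> \bar R) (x0 : E) (G : E -> E').
Hypothesis phiN : forall x, phi x != -oo%E.
Hypothesis cphi : strictly_convex phi.
Let A := sublevel phi x0.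
Hypothesis GP : forall x, A x -> subdiff phi x (G x).

Lemma sublevel_convex x y (t : R) : A x -> A y -> 0 < t < 1 ->
  A (t *: x + (1 - t) *: y).
Proof.
move=> Ax Ay t01; have [->|xy] := eqVneq x y.
  by rewrite -scalerDl addrC subrK scale1r.
move: (Ax) (Ay) => [dx xx0] [dy yx0].
have [a xa] := proper_edom_fin phiN dx.
have [b yb] := proper_edom_fin phiN dy.
have := cphi dx dy xy t01; rewrite xa yb -!EFinM -EFinD => lt.
have le : (phi (t *: x + (1 - t) *: y)%R <= phi x0)%E.
  apply: (le_trans (ltW lt)); case/andP: t01 => t0 t1.
  have [ab|/ltW ba] := leP a b.
    by rewrite (le_trans _ yx0)// yb lee_fin; nra.
  by rewrite (le_trans _ xx0)// xa lee_fin; nra.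
by split => //; exact: lt_trans lt (ltry _).
Qed.

Let half : 1 - 2^-1 = 2^-1 :> R.
Proof. lra. Qed.

Let half01 : 0 < (2^-1 : R) < 1.
Proof. by apply/andP; split; lra. Qed.

Let beta_algebra (a b c p r : R) : a + - 2^-1 * p <= c -> b + 2^-1 * r <= c ->
  c < 2^-1 * a + (1 - 2^-1) * b -> 0 < p - r.
Proof. lra. Qed.

(** Both subgradient inequalities are evaluated at the midpoint [m], where strict convexity makes
    their sum strict. *)
Lemma beta_F_gt0 x y : A x -> A y -> x != y -> 0 < beta_F G x y.
Proof.
move=> Ax Ay xy; have [dx Gx] := GP Ax; have [dy Gy] := GP Ay.
have [a xa] := proper_edom_fin phiN dx.
have [b yb] := proper_edom_fin phiN dy.
pose m : E := 2^-1 *: x + (1 - 2^-1) *: y.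
have := cphi dx dy xy half01; rewrite -/m => lt.
have [c mc] : exists c, phi m = c%:E.
  apply: proper_edom_fin phiN _; apply: lt_trans lt _.
  by rewrite xa yb -!EFinM -EFinD ltry.
have mx : m - x = - 2^-1 *: (x - y).
  by rewrite /m conv_subl half scaleNr -scalerN opprB.
have my : m - y = 2^-1 *: (x - y) by rewrite /m conv_subr.
move: (Gx m) (Gy m) lt; rewrite mx my xa yb mc -!EFinM -!EFinD !lee_fin lte_fin.
rewrite (_ : G x (_ *: _) = - 2^-1 * G x (x - y)); last exact: linearZ.
rewrite (_ : G y (_ *: _) = 2^-1 * G y (x - y)); last exact: linearZ.
rewrite /beta_F add_lfunE opp_lfunE; exact: beta_algebra.
Qed.

Let VF := V_F G A.
Hypothesis VFfin : (VF < +oo)%E.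
Hypothesis A2 : exists x y, [/\ A x, A y & x != y].

Lemma V_F_ge x y : A x -> A y -> beta_F G x y <= fine VF.
Proof.
move=> Ax Ay.
have : ((beta_F G x y)%:E <= VF)%E by apply: ereal_sup_ubound; exists (x, y).
by move: VFfin; case: VF.
Qed.

Lemma V_F_gt0 : 0 < fine VF.
Proof.
have [x [y [Ax Ay xy]]] := A2.
exact: lt_le_trans (beta_F_gt0 Ax Ay xy) (V_F_ge Ax Ay).
Qed.

Variable s : R.
Hypothesis s2 : 2 <= s.
Let s0 : 0 < s.
Proof. exact: lt_le_trans s2. Qed.

Let s1 : 0 < s - 1.
Proof. by rewrite subr_gt0; apply: lt_le_trans s2; rewrite ltr1n. Qed.

Let D := relative_size G A s.
Hypothesis Dfin : (D < +oo)%E.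

Lemma relative_size_ge x y : A x -> A y -> x != y ->
  `|x - y| * xi_F G A x y `^ (- s^-1) <= fine D.
Proof.
move=> Ax Ay xy.
have : ((`|x - y| * xi_F G A x y `^ (- s^-1))%:E <= D)%E.
  by apply: ereal_sup_ubound; exists (x, y).
by move: Dfin; case: D.
Qed.

Lemma relative_size_ge0 : 0 <= fine D.
Proof.
have [x [y [Ax Ay xy]]] := A2.
by apply: le_trans (relative_size_ge Ax Ay xy); rewrite mulr_ge0// powR_ge0.
Qed.

(** The inequality $\|x-y\|\,\xi_F^{-1/s}\le D_s$ is raised to the power $s$ and $V_F$ is cleared
    from $\xi_F$. *)
Lemma beta_F_uniform x y : A x -> A y -> x != y ->
  fine VF * `|x - y| `^ s <= fine D `^ s * beta_F G x y.
Proof.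
move=> Ax Ay xy; have := relative_size_ge Ax Ay xy.
have b0 := beta_F_gt0 Ax Ay xy; have V0 := V_F_gt0.
have xi0 : 0 < xi_F G A x y by rewrite divr_gt0.
rewrite powRN ler_pdivrMr ?powR_gt0// => le.
rewrite mulrC -ler_pdivlMr// -mulrA -/(xi_F G A x y).
apply: (@le_trans _ _ ((fine D * xi_F G A x y `^ s^-1) `^ s)).
  by rewrite ge0_ler_powR ?nnegrE ?mulr_ge0 ?powR_ge0 ?relative_size_ge0// ltW.
rewrite powRM ?powR_ge0 ?relative_size_ge0// -powRrM mulVf ?gt_eqF//.
by rewrite powRr1// ltW.
Qed.

(** In use, [cs] is $c^s$ and [n] is $\|x-y\|^s$; [p1], [p2] are the values on $x-y$ of the given
    subgradients at the endpoints, [g1], [g2] those of the selected ones at interior points. *)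
Let uniform_algebra (e c cs t v d n p1 p2 g1 g2 : R) : 0 < e -> 0 < c -> 0 <= d ->
  cs = c * (1 - t) -> 0 <= - e * (p2 - g2) -> 0 <= e * (p1 - g1) ->
  v * (cs * n) <= d * (c * (g1 - g2)) ->
  0 <= d * (p1 - p2) - v * n + t * (v * n).
Proof.
move=> e0 c0 d0 ->; rewrite mulNr oppr_ge0 pmulr_rle0// pmulr_rge0// => h2 h1.
rewrite -mulrA [v * _]mulrCA [d * (c * _)]mulrCA ler_pM2l// => h3.
have : d * (g1 - g2) <= d * (p1 - p2) by rewrite ler_wpM2l//; lra.
nra.
Qed.

(* The subgradients of the method need not be the selected ones: compare them
   with the selection at interior points of the segment. *)
Lemma subgradient_uniform x y sx sy : A x -> A y ->
  subdiff phi x sx -> subdiff phi y sy ->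
  fine VF * `|x - y| `^ s <= fine D `^ s * (sx - sy) (x - y).
Proof.
move=> Ax Ay dsx dsy.
have [->|xy] := eqVneq x y.
  by rewrite subrr normr0 powR0 ?linear0 ?mulr0// gt_eqF.
have m0 := subdiff_monotone phiN dsx dsy.
have V0 := V_F_gt0.
have n0 : 0 < `|x - y| by rewrite normr_gt0 subr_eq0.
rewrite -subr_ge0.
(* It suffices to prove the estimate with $(1-t)V_F$ in place of $V_F$; for $t=1$ this is
   monotonicity. *)
apply: (@ge0_of_ge0_addM _ _ (fine VF * `|x - y| `^ s)) => t /andP[t0 t1].
have [->|tn1] := eqVneq t 1.
  by rewrite mul1r subrK mulr_ge0// powR_ge0.
have t01 : 0 < 1 - t by rewrite subr_gt0 lt_neqAle tn1.
(* On the segment shrunk by [c] the norm term scales by $c^s=c(1-t)$ and the pairing by $c$, which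
   leaves the factor $1-t$. A fraction [e] is cut off at either end, so that $1-2e=c$. *)
pose c := (1 - t) `^ (s - 1)^-1.
have c0 : 0 < c by rewrite powR_gt0.
have cE : c `^ (s - 1) = 1 - t.
  by rewrite /c -powRrM mulVf ?gt_eqF// powRr1// ltW.
have c1 : c < 1.
  have := @gt0_ltr_powR R (s - 1)^-1; rewrite invr_gt0 => /(_ s1 (1 - t) 1).
  by rewrite !nnegrE powR1 /c; apply; [exact: ltW|by []|lra].
pose e := (1 - c) / 2.
have e01 : 0 < e < 1 by rewrite /e; lra.
have e01' : 0 < 1 - e < 1 by rewrite /e; lra.
pose z := (1 - e) *: x + (1 - (1 - e)) *: y.
pose w := e *: x + (1 - e) *: y.
have Az : A z by exact: sublevel_convex.
have Aw : A w by exact: sublevel_convex.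
have zw : z - w = c *: (x - y).
  rewrite -(subrKA y) -[y - w]opprB /z /w !conv_subr -[X in _ + X]scaleNr -scalerDl.
  by congr (_ *: _); rewrite /e; field.
have xz : x - z = e *: (x - y).
  by rewrite -[x - z]opprB /z conv_subl subKr -scalerN opprB.
have yw : y - w = - e *: (x - y) by rewrite -[y - w]opprB /w conv_subr scaleNr.
have zw0 : z != w by rewrite -subr_eq0 zw scaler_eq0 subr_eq0 negb_or gt_eqF.
have := beta_F_uniform Az Aw zw0.
(* As $x-z$ and $w-y$ are positive multiples of $x-y$, monotonicity orders given and selected
   subgradients in that direction. *)
have := subdiff_monotone phiN dsx (GP Az).
have := subdiff_monotone phiN dsy (GP Aw).
rewrite /beta_F xz yw zw normrZ gtr0_norm// powRM ?(ltW c0)//.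
rewrite (_ : (sy - G w) _ = - e * (sy - G w) (x - y)); last exact: linearZ.
rewrite (_ : (sx - G z) _ = e * (sx - G z) (x - y)); last exact: linearZ.
rewrite (_ : (G z - G w) _ = c * (G z - G w) (x - y)); last exact: linearZ.
rewrite !add_lfunE !opp_lfunE.
apply: uniform_algebra => //; first by case/andP: e01.
  exact: powR_ge0.
rewrite -cE -[X in X * _](powRr1 (ltW c0)) -powRD; first by congr (_ `^ _); ring.
by rewrite (gt_eqF c0) implybT.
Qed.

End RelativeSize.

(** * Convergence rate *)

Section Rate.
Context (R : realType).
Implicit Types (q s K V D g r lambda : R).

(** Cancelling one [r] in the uniform convexity estimate gives $r\le(D^sg/V)^{1/(s-1)}$. The 16 is
    the product of the fours in the bounds on [lambda] and [g'], and the exponents $\frac{q-2}{q-1}$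
    and $\frac1{s-1}$ of [g] add up to $1+\zeta$. *)
Lemma superlinear_step q s K V D g g' lambda r : 2 <= s < q ->
  0 <= K -> 0 < V -> 0 <= D -> 0 < g -> 0 <= r -> 0 < lambda ->
  lambda <= 4 * (K * g `^ ((q - 2) / (q - 1))) ->
  V * r `^ s <= D `^ s * (g * r) ->
  g' <= 4 * lambda * r ->
  g' <= (V `^ (1 / (s - 1)) / (16 * D `^ (s / (s - 1)) * K))^-1
        * g `^ (1 + (q - s) / ((s - 1) * (q - 1))).
Proof.
move=> /andP[s2 sq] K0 V0 D0 g0 r0 l0 lle rle g'le.
have s1 : 0 < s - 1 by lra.
have q1 : 0 < q - 1 by lra.
have [r00|rn0] := eqVneq r 0.
  rewrite r00 mulr0 in g'le; apply: (le_trans g'le).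
  by rewrite mulr_ge0 ?invr_ge0 ?divr_ge0 ?mulr_ge0 ?powR_ge0.
have {rn0} r1 : 0 < r by rewrite lt0r rn0.
have rs : r `^ (s - 1) <= D `^ s * g / V.
  have rsE : r * r `^ (s - 1) = r `^ s by rewrite mulr_powRB1//; lra.
  rewrite ler_pdivlMr// -(ler_pM2l r1) mulrA rsE mulrC (le_trans rle)//.
  by have -> : D `^ s * (g * r) = r * (D `^ s * g) by ring.
have r_le : r <= D `^ (s / (s - 1)) * g `^ (1 / (s - 1)) / V `^ (1 / (s - 1)).
  have -> : r = (r `^ (s - 1)) `^ (1 / (s - 1)).
    by rewrite -powRrM mul1r divff ?gt_eqF// powRr1.
  apply: (@le_trans _ _ ((D `^ s * g / V) `^ (1 / (s - 1)))).
    apply: ge0_ler_powR; rewrite ?nnegrE ?powR_ge0//.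
      by rewrite mul1r invr_ge0 ltW.
    by rewrite divr_ge0 ?mulr_ge0 ?powR_ge0// ltW.
  rewrite !powRM ?mulr_ge0 ?powR_ge0 ?invr_ge0 ?(ltW g0) ?(ltW V0)//.
  rewrite -powRrM -[V^-1]powR_inv1 ?(ltW V0)// -powRrM mulN1r powRN.
  by rewrite mulrA mulr1.
have -> : 1 + (q - s) / ((s - 1) * (q - 1)) = (q - 2) / (q - 1) + 1 / (s - 1).
  by field; rewrite !gt_eqF.
rewrite powRD; last by rewrite (gt_eqF g0) implybT.
apply: (le_trans g'le); rewrite invf_div.
set W := V `^ _ in r_le *; set DD := D `^ (s / (s - 1)) in r_le *.
set gs := g `^ (1 / (s - 1)) in r_le *; set gp := g `^ _ in lle *.
have -> : 16 * DD * K / W * (gp * gs) = 4 * (4 * (K * gp)) * (DD * gs / W) by ring.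
rewrite ler_pM ?mulr_ge0// ?(ltW l0)//.
by rewrite ler_wpM2l.
Qed.

(** $g^{\alpha-p}$ is nondecreasing in $g$ because $p\le\alpha$. *)
Lemma regularization_decr (alpha p K H g g' : R) : p <= alpha -> 0 <= H ->
  0 < g' -> g' <= g ->
  H * g `^ alpha <= K * g `^ p -> H * g' `^ alpha <= K * g' `^ p.
Proof.
move=> pa H0 g'0 g'g; have g0 : 0 < g by exact: lt_le_trans g'g.
have E (t : R) : 0 < t -> t `^ alpha = t `^ (alpha - p) * t `^ p.
  by move=> t0; rewrite -powRD ?subrK// (gt_eqF t0) implybT.
rewrite !E// !mulrA !ler_pM2r ?powR_gt0//; apply: le_trans.
by rewrite ler_wpM2l// ge0_ler_powR ?nnegrE ?subr_ge0// ltW.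
Qed.

Lemma superlinear_decr (Delta zeta g g' : R) : 0 < Delta -> 0 < zeta ->
  0 < g <= Delta -> g' <= (Delta `^ zeta)^-1 * g `^ (1 + zeta) -> g' <= g.
Proof.
move=> D0 z0 /andP[g0 gD]; move/le_trans; apply.
rewrite mulrC ler_pdivrMr ?powR_gt0// powRD; last by rewrite (gt_eqF g0) implybT.
rewrite powRr1 ?(ltW g0)// ler_pM2l// ge0_ler_powR ?nnegrE//; exact: ltW.
Qed.

(** The step reads $g'/\Delta\le(g/\Delta)^{1+\zeta}$, so the exponent is multiplied by
    $1+\zeta$. *)
Lemma double_exponential_step (Delta zeta g g' : R) (k : nat) : 0 < Delta ->
  0 < zeta -> 0 <= g -> g <= Delta * expR (- (1 + zeta) ^+ k) ->
  g' <= (Delta `^ zeta)^-1 * g `^ (1 + zeta) ->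
  g' <= Delta * expR (- (1 + zeta) ^+ k.+1).
Proof.
move=> D0 z0 g0 gle; move/le_trans; apply.
have z1 : 0 <= 1 + zeta by lra.
rewrite mulrC ler_pdivrMr ?powR_gt0//.
apply: (@le_trans _ _ ((Delta * expR (- (1 + zeta) ^+ k)) `^ (1 + zeta))).
  by rewrite ge0_ler_powR// nnegrE ?mulr_ge0 ?expR_ge0// ltW.
rewrite powRM ?expR_ge0 ?(ltW D0)// powRD; last by rewrite (gt_eqF D0) implybT.
rewrite powRr1 ?(ltW D0)// mulrAC ler_pM2r ?powR_gt0// ler_pM2l//.
by rewrite -expRM mulNr -exprSr.
Qed.

Lemma le_absz_ceil (x : R) : x <= `|(Num.max 0 (Num.ceil x))%R|%N%:R.
Proof.
rewrite natr_absz ger0_norm ?le_max ?lexx// (le_trans (ceil_ge _))//.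
by rewrite ler_int le_max lexx orbT.
Qed.

(** For $y=\ln(\Delta/\delta)>0$ the condition on [k] says $(1+\zeta)^k\ge y$, and $\Delta
    e^{-y}=\delta$. *)
Lemma iteration_count (Delta delta zeta : R) (k : nat) :
  0 < Delta -> 0 < delta -> 0 < zeta ->
  1 / ln (1 + zeta) * ln (ln (Delta / delta)) <= k%:R ->
  Delta * expR (- (1 + zeta) ^+ k) <= delta.
Proof.
move=> D0 d0 z0; set y := ln (Delta / delta) => kX.
have lz : 0 < ln (1 + zeta) by rewrite ln_gt0//; lra.
have dE : delta = Delta * expR (- y).
  rewrite expRN lnK ?posrE ?divr_gt0// invf_div mulrCA divff ?gt_eqF//.
  by rewrite mulr1.
rewrite [leRHS]dE ler_pM2l// ler_expR lerN2.
(* When $y\le0$, that is $\delta\ge\Delta$, every [k] works. *)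
have [y0|y0] := leP y 0.
  by rewrite (le_trans y0)// exprn_ge0//; lra.
rewrite -(@lnK _ ((1 + zeta) ^+ k)) ?posrE ?exprn_gt0//; last by lra.
rewrite -[leLHS](@lnK _ y)// ler_expR lnXn; last by lra.
rewrite -mulr_natl -ler_pdivrMr//.
by rewrite mul1r mulrC in kX.
Qed.

End Rate.

(** * One iteration of the method *)

Section Run.
Context (R : realType) (V : vectType R) (B : metric_op V).
Local Notation E := (euclid B).
Local Notation E' := 'Hom(euclid B, R).
Variables (f : E -> R) (psi : E -> \bar R) (x0 : E) (alpha q : R).
Hypothesis cf : convex_function [set: E] f.
Hypothesis f2 : times_differentiable 2 f.
Hypothesis cpsi : proper_closed_convex psi.
Hypothesis E2 : exists x y : E, x != y.
Hypothesis q24 : 2 < q <= 4.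
Hypothesis Mfin : (M_const f q < +oo)%E.
Local Notation F := (objective f psi).
Local Notation K := ((6 * fine (M_const f q)) `^ (1 / (q - 1))).
Local Notation p := ((q - 2) / (q - 1)).

Lemma M_const_ge0 : 0 <= fine (M_const f q).
Proof.
by move: Mfin; rewrite /M_const; case: ifP => _; exact: L_const_ge0.
Qed.

Lemma objective_neqNy x : F x != -oo%E.
Proof.
have [psiN _ _ _] := cpsi; rewrite /objective.
by have := psiN x; case: (psi x).
Qed.

Lemma objective_edom x : edom psi x -> edom F x.
Proof. by rewrite /edom /objective /=; case: (psi x) => // r _; rewrite ltry. Qed.

Lemma objective_subdiff x s : subdiff psi x s -> subdiff F x (comp_grad f x s).
Proof.
have [psiN _ _ _] := cpsi; move=> [dx sx].
split=> [|y]; first exact: objective_edom.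
have [a xa] := proper_edom_fin psiN dx.
have := sx y; rewrite /objective xa comp_gradE gradE// => h.
have df z : differentiable f z by case: f2.
have h' := convex_derive_le cf df x y.
rewrite -!EFinD.
have -> : f x + a + ('D_(y - x) f x + s (y - x)) =
  (f x + 'D_(y - x) f x) + (a + s (y - x)) by ring.
by rewrite EFinD leeD// lee_fin.
Qed.

(** The bound on the new regularization constant still refers to the old gradient size. The final
    sign condition later allows $F'(x_{k+1})$ to be dropped from the uniform convexity estimate. *)
Lemma newton_step_estimate st st' :
  newton_step f psi alpha st st' -> 0 < grad_size f st ->
  sublevel F x0 (cur_point st) -> subdiff psi (cur_point st) (cur_subgrad st) ->
  0 < cur_reg st ->
  cur_reg st * grad_size f st `^ alpha <= K * grad_size f st `^ p ->
  [/\ sublevel F x0 (cur_point st'),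
      subdiff psi (cur_point st') (cur_subgrad st'),
      0 < cur_reg st',
      cur_reg st' * grad_size f st `^ alpha <= K * grad_size f st `^ p &
      exists2 lambda, 0 < lambda <= 4 * (K * grad_size f st `^ p) &
        grad_size f st' <= 4 * lambda * `|cur_point st - cur_point st'| /\
        0 <= comp_grad f (cur_point st') (cur_subgrad st')
               (cur_point st - cur_point st')].
Proof.
move=> + g0 Ax sx H0 Hle; rewrite /newton_step gt_eqF//.
move=> [j [[zmin acc] rej sE HE]].
set g := grad_size f st in g0 Hle rej zmin acc sE HE *.
set x := cur_point st in Ax sx rej zmin acc sE *.
set z := cur_point st' in zmin acc sE *.
pose lam i := 4 ^+ i * cur_reg st * g `^ alpha.
have ga : 0 < g `^ alpha by rewrite powR_gt0.
have l0 i : 0 < lam i by rewrite !mulr_gt0// exprn_gt0.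
have [psiN _ _ _] := cpsi.
have domx : edom psi x by case: sx.
have sz : subdiff psi z (cur_subgrad st').
  by rewrite sE; have := newton_subgrad_subdiff f2 cpsi domx zmin.
have H'0 : 0 < cur_reg st' by rewrite HE !mulr_gt0// exprn_gt0.
(* The final division by four turns $\lambda_j\le4Kg^p$ into the bound on the new constant. *)
have Hg : cur_reg st' * g `^ alpha = lam j / 4 by rewrite HE /lam mulrAC.
have q2 : 2 <= q by case/andP: q24 => /ltW.
(* Rejection speaks of minimizers of the model, so a minimizer has to be exhibited first. *)
have lam_rej i : (i < j)%N -> lam i <= K * g `^ p.
  move=> ij; have [w wmin] := newton_point_exists f2 cf cpsi sx (l0 i).
  apply: (lambda_le_of_rejected q2 (l0 i) g0 M_const_ge0).
  rewrite leNgt; apply/negP => /ltW lt.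
  apply: (rej i w ij wmin).
  exact: (accepted_of_lambda_ge cf f2 cpsi E2 q24 Mfin sx g0 (l0 i) wmin lt).
(* For $j=0$ the inherited bound applies; otherwise $\lambda_j$ is four times a rejected value. *)
have lamj : lam j <= 4 * (K * g `^ p).
  case: (posnP j) => [j0|j0].
    rewrite j0 /lam expr0 mul1r (le_trans Hle)// ler_peMl ?ler1n//.
    by rewrite mulr_ge0 ?powR_ge0.
  have -> : lam j = 4 * lam j.-1 by rewrite /lam -{1}(prednK j0) exprS !mulrA.
  by rewrite ler_pM2l// lam_rej// prednK.
have acc' : (4 * lam j)^-1 * grad_size f st' ^+ 2
    <= comp_grad f z (cur_subgrad st') (x - z).
  by move: acc; rewrite /accepted -sE.
have l4 : 0 < 4 * lam j by rewrite mulr_gt0.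
have Fge0 : 0 <= comp_grad f z (cur_subgrad st') (x - z).
  by apply: le_trans acc'; rewrite mulr_ge0 ?sqr_ge0// invr_ge0 ltW.
have [dz Fz] := objective_subdiff sz.
split => //.
(* The subgradient inequality at [z], with a nonnegative pairing, shows that $F$ does not
   increase. *)
- split => //; have [_ xx0] := Ax; apply: le_trans xx0.
  by apply: le_trans (Fz x); rewrite leeDl// lee_fin.
- by rewrite Hg ler_pdivrMr// mulrC.
exists (lam j); first by rewrite l0.
split => //.
(* Acceptance gives $g'^2/(4\lambda)\le g'r$, and one $g'$ is cancelled. *)
have := le_dual_norm (comp_grad f z (cur_subgrad st')) (x - z).
rewrite (_ : dual_norm _ = grad_size f st')// => /(le_trans acc').
rewrite mulrC ler_pdivrMr//.
have [->|gn0] := eqVneq (grad_size f st') 0.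
  by move=> _; rewrite mulr_ge0// ltW.
have g'0 : 0 < grad_size f st' by rewrite lt0r gn0 sqrtr_ge0.
by rewrite expr2 -[leRHS]mulrA => h; rewrite mulrC -(ler_pM2l g'0).
Qed.

Lemma H_bound_le (H g : R) : 0 < g -> (H%:E <= H_bound f alpha g)%E ->
  H * g `^ alpha <= K * g `^ p.
Proof.
move=> g0 le.
have : (H%:E <= poweR (6%:E * M_const f q) (q - 1)^-1 * (g^-1 `^ (alpha - p))%:E)%E.
  apply: (le_trans le); apply: ereal_inf_lbound; exists q => //=.
  by case/andP: q24 => /ltW -> ->.
have q1 : (q - 1)^-1 != 0.
  by rewrite invr_eq0 subr_eq0 gt_eqF// (lt_trans _ (andP q24).1)// ltr1n.
move: Mfin M_const_ge0; rewrite mul1r.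
(* At [-oo], [fine] is zero and both powers vanish, as their exponent is nonzero; the hypothesis
   then reads $H\le0$. *)
case: (M_const f q) => [M _ M0| |_ _] //; last first.
  rewrite gt0_muleNy ?lte_fin// poweRNyr// mul0e lee_fin /= mulr0 powR0// mul0r.
  by move=> H0; rewrite mulr_le0_ge0// powR_ge0.
rewrite (_ : (6%:E * M%:E)%E = (6 * M)%:E)// poweR_EFin -EFinM lee_fin /= => h.
have g1 : 0 < g `^ alpha by rewrite powR_gt0.
rewrite -(ler_pM2r g1) in h; apply: (le_trans h).
rewrite -mulrA -[g^-1]powR_inv1 ?(ltW g0)// -powRrM mulN1r opprB -powRD.
  by rewrite subrK.
by rewrite (gt_eqF g0) implybT.
Qed.

End Run.

Theorem theorem6 (R : realType) (V : vectType R) (B : metric_op V)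
    (f : euclid B -> R) (psi : euclid B -> \bar R)
    (G : euclid B -> 'Hom(euclid B, R))
    (alpha : R) (st : nat -> newton_state B) (q s : R) :
  let F := objective f psi in
  let F0 := sublevel F (cur_point (st 0%N)) in
  let g k := grad_size f (st k) in
  let VF := V_F G F0 in
  let Ds := relative_size G F0 s in
  let Mq := M_const f q in
  let zeta := (q - s) / ((s - 1) * (q - 1)) in
  let Delta :=
    (fine VF `^ (1 / (s - 1))
     / (16 * fine Ds `^ (s / (s - 1)) * (6 * fine Mq) `^ (1 / (q - 1))))
    `^ (1 / zeta) in
  convex_function [set: euclid B] f ->
  times_differentiable 2 f ->
  proper_closed_convex psi ->
  strictly_convex F ->
  2 / 3 <= alpha <= 1 ->
  newton_run f psi alpha st ->
  0 < g 0%N ->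
  (exists x y, [/\ F0 x, F0 y & x != y]) ->
  (diameter F0 < +oo)%E ->
  (forall x, F0 x -> subdiff F x (G x)) ->
  (VF < +oo)%E ->
  ((cur_reg (st 0%N))%:E <= H_bound f alpha (g 0%N))%E ->
  2 <= q <= 4 -> (Mq < +oo)%E ->
  2 <= s < q -> (Ds < +oo)%E ->
  g 0%N <= (expR 1)^-1 * Delta ->
  forall delta : R, 0 < delta ->
    (* ln vanishes on negative reals: for delta >= Delta the ceiling is 0. *)
    let k := `|(Num.max 0 (Num.ceil (1 / ln (1 + zeta) * ln (ln (Delta / delta)))))%R|%N in
    g k <= delta.
Proof.
move=> F F0 g VF Ds Mq zeta Delta cf f2 cpsi sF a01 run g00 A2 _ GP VFfin HH q24 Mfin
  s2q Dfin g0le delta d0; cbv zeta.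
have [domx0 sx0 H00 steps] := run.
have [s2 sq] := andP s2q; have [q2' q4] := andP q24; have [a23 a1] := andP a01.
have q2 : 2 < q by exact: le_lt_trans sq.
have q24' : 2 < q <= 4 by rewrite q2.
have q1 : 0 < q - 1 by lra.
have s1 : 0 < s - 1 by lra.
have E2 : exists x y : euclid B, x != y.
  by have [x [y [_ _ xy]]] := A2; exists x, y.
have FN : forall x, F x != -oo%E by exact: objective_neqNy.
have V0 : 0 < fine VF by exact: V_F_gt0 FN sF GP VFfin A2.
have D0 : 0 <= fine Ds by have := relative_size_ge0 A2 Dfin.

have M0 : 0 <= fine Mq by exact: M_const_ge0.
have z0 : 0 < zeta by rewrite divr_gt0 ?mulr_gt0// subr_gt0.
pose K := (6 * fine Mq) `^ (1 / (q - 1)).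
pose p := (q - 2) / (q - 1).
have K0 : 0 <= K by exact: powR_ge0.
pose C := fine VF `^ (1 / (s - 1)) / (16 * fine Ds `^ (s / (s - 1)) * K).
have C0 : 0 <= C by rewrite divr_ge0 ?mulr_ge0 ?powR_ge0.
(* Zero denominators would make [Delta] zero by the division convention; $0<g_0\le\Delta/e$ rules
   this out. *)
have Delta0 : 0 < Delta.
  rewrite lt0r powR_ge0 andbT; apply/eqP => D00.
  by move: g0le; rewrite D00 mulr0 leNgt g00.
have CE : C = Delta `^ zeta.
  by rewrite -powRrM divfK ?gt_eqF// powRr1.
(* $p\le2/3$ is equivalent to $q\le4$. *)
have pa : p <= alpha.
  by rewrite (le_trans _ a23)// ler_pdivrMr//; lra.
(* At $n=0$ the last bound is the assumption $g_0\le\Delta/e$. The bound on the regularization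
   constant is claimed only before the method stops. *)
have inv n : [/\ F0 (cur_point (st n)),
    subdiff psi (cur_point (st n)) (cur_subgrad (st n)), 0 < cur_reg (st n),
    0 < g n -> cur_reg (st n) * g n `^ alpha <= K * g n `^ p &
    g n <= Delta * expR (- (1 + zeta) ^+ n)].
  elim: n => [|n [An sn Hn Hgn gn]].
    split => //.
    - by split=> //; exact: objective_edom.
    - by move=> _; exact: H_bound_le.
    - by rewrite expr0 expRN mulrC.
  have [gn0|gn0] := eqVneq (g n) 0.
    have := steps n; rewrite /newton_step -/(g n) gn0 eqxx => stE.
    have gS : g n.+1 = 0 by rewrite /g stE.
    rewrite gS stE; split => //; first by rewrite ltxx.
    by rewrite mulr_ge0 ?expR_ge0// ltW.
  have gn1 : 0 < g n by rewrite lt0r gn0 sqrtr_ge0.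
  have [AS sS HS HgS [lambda /andP[l0 lle] [gSle Fge0]]] :=
    newton_step_estimate cf f2 cpsi E2 q24' Mfin (steps n) gn1 An sn Hn (Hgn gn1).
  set r := `|cur_point (st n) - cur_point (st n.+1)| in gSle.
  (* The pairing of $F'(x_{n+1})$ with $x_n-x_{n+1}$ is nonnegative and is subtracted, so only that
     of $F'(x_n)$ remains, at most $g_nr$. *)
  have rle : fine VF * r `^ s <= fine Ds `^ s * (g n * r).
    have dn := objective_subdiff cf f2 cpsi sn.
    have dS := objective_subdiff cf f2 cpsi sS.
    apply: le_trans (subgradient_uniform FN sF GP VFfin A2 s2 Dfin An AS dn dS) _.
    rewrite ler_wpM2l ?powR_ge0// add_lfunE opp_lfunE.
    apply: le_trans (le_dual_norm _ _); rewrite gerBl; exact: Fge0.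
  have r0 : 0 <= r by exact: normr_ge0.
  have step := superlinear_step s2q K0 V0 D0 gn1 r0 l0 lle rle gSle.
  rewrite -/C CE in step.
  have gS := double_exponential_step Delta0 z0 (ltW gn1) gn step.
  split; [exact: AS|exact: sS|exact: HS| |exact: gS].
  (* The bound passes from $g_n$ to $g_{n+1}$ because $g_n\le\Delta$ forces $g_{n+1}\le g_n$. *)
  move=> gS0; apply: regularization_decr pa (ltW HS) gS0 _ HgS.
  apply: (superlinear_decr Delta0 z0 _ step); rewrite gn1 (le_trans gn)//.
  rewrite ler_piMr ?(ltW Delta0)// -[leRHS]expR0 ler_expR oppr_le0 exprn_ge0//.
  by rewrite addr_ge0// ltW.
set k := absz _. have [_ _ _ _ gk] := inv k; apply: le_trans gk _.
by apply: iteration_count => //; exact: le_absz_ceil.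
Qed.
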